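(* Let $\Gamma$ be a non-elementary hyperbolic group, let $X$ be a Gromov-hyperbolic, proper, geodesic metric space and $G=\mathrm{Isom}(X)$, and let $A$ be a characteristic subgroup of $\Gamma$. A representation $\rho\in\mathrm{Hom}(\Gamma,G)$ is $A$-stable if and only if it is $A$-well-displacing.
   Context: Fix a finite generating set $S$ of $\Gamma$, Cayley graph $C_S(\Gamma)$ with word metric $d_S$; $l_S(\gamma)=\inf_{y\in C_S(\Gamma)}d_S(y,\gamma y)$ is the translation length of $\gamma$, and for $g\in G$, $l(g)=\inf_{x\in X}d(x,gx)$. Non-elementary means $\Gamma$ contains a free subgroup of rank 2. For $\rho$ and $x\in X$, the orbit map $\tau_{\rho,x}:C_S(\Gamma)\to X$ is the $\rho$-equivariant map with $\tau_{\rho,x}(\gamma)=\rho(\gamma)(x)$ on vertices and sending edges to geodesic segments. A $(K,C)$ quasi-geodesic is the image of a map $f$ from $\mathbb{Z}$ or $\mathbb{R}$ with $\frac1K|s-t|-C\leqslant d(f(s),f(t))\leqslant K|s-t|+C$. For infinite order $a\in\Gamma$, $L_S(a)$ is the set of geodesics of $C_S(\Gamma)$ joining the two fixed points $a^-,a^+\in\partial C_S(\Gamma)$ of $a$; $L_S(A)$ is the union of $L_S(a)$ over infinite order $a\in A$. $\rho$ is $A$-stable if there are $K\geqslant1$, $C\geqslant0$, $x\in X$ such that $\tau_{\rho,x}$ maps every geodesic of $L_S(A)$ to a $(K,C)$ quasi-geodesic. $\rho$ is $A$-well-displacing if there are $J\geqslant1$, $B\geqslant0$ with $\frac1J l_S(a)-B\leqslant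 l(\rho(a))\leqslant Jl_S(a)+B$ for all $a\in A$. *)

(* Defs.v *)
From Stdlib Require Import Reals List.
From Coquelicot Require Import Rbar Lub.
Import ListNotations.
Open Scope R_scope.

Record Group := {
  gcar :> Type;
  gmul : gcar -> gcar -> gcar;
  ginv : gcar -> gcar;
  gone : gcar;
  gmulA : forall x y z, gmul x (gmul y z) = gmul (gmul x y) z;
  gmul1l : forall x, gmul gone x = x;
  gmul1r : forall x, gmul x gone = x;
  gmulVl : forall x, gmul (ginv x) x = gone;
  gmulVr : forall x, gmul x (ginv x) = gone }.
Arguments gmul {_} _ _.
Arguments ginv {_} _.
Arguments gone {_}.

Fixpoint gpow {G : Group} (a : G) (n : nat) : G :=
  match n with O => gone | S m => gmul a (gpow a m) end.

Definition infinite_order {G : Group} (a : G) : Prop :=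
  forall n, (0 < n)%nat -> gpow a n <> gone.

Definition word_eval {G : Group} (w : list (G * bool)) : G :=
  fold_right (fun (p : G * bool) (acc : G) => gmul (if snd p then ginv (fst p) else fst p) acc) gone w.

Definition is_word {G : Group} (S : list G) (w : list (G * bool)) : Prop :=
  Forall (fun p => In (fst p) S) w.

Definition generates {G : Group} (S : list G) : Prop :=
  forall g : G, exists w, is_word S w /\ word_eval w = g.

Definition word_dist {G : Group} (S : list G) (g h : G) : R :=
  real (Glb_Rbar (fun r => exists w, is_word S w /\
          word_eval w = gmul (ginv g) h /\ r = INR (length w))).

Definition subgroup {G : Group} (A : G -> Prop) : Prop :=
  A gone /\ (forall x y, A x -> A y -> A (gmul x y)) /\ (forall x, A x -> A (ginv x)).

Definition automorphism {G : Group} (phi : G -> G) : Prop :=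
  (forall x y, phi (gmul x y) = gmul (phi x) (phi y)) /\
  (forall x y, phi x = phi y -> x = y) /\ (forall y, exists x, phi x = y).

Definition characteristic {G : Group} (A : G -> Prop) : Prop :=
  subgroup A /\ forall phi, automorphism phi -> forall g, A (phi g) <-> A g.

(* non-elementary: contains a free subgroup of rank 2, i.e. there are a, b
   such that no nonempty reduced word in a^{±1}, b^{±1} is trivial.
   A letter is (which generator: false=a/true=b, inverted?). *)
Fixpoint reduced (w : list (bool * bool)) : Prop :=
  match w with
  | x :: ((y :: _) as t) => ~ (fst x = fst y /\ snd x <> snd y) /\ reduced t
  | _ => True
  end.

Definition non_elementary (G : Group) : Prop :=
  exists a b : G, forall w : list (bool * bool), w <> [] -> reduced w ->
    word_eval (map (fun l : bool * bool => (if fst l then b else a, snd l)) w) <> gone.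

Definition gprod {T : Type} (d : T -> T -> R) (w x y : T) : R :=
  (d x w + d y w - d x y) / 2.

Definition gromov_hyperbolic {T : Type} (d : T -> T -> R) : Prop :=
  exists delta, 0 <= delta /\ forall x y z w,
    gprod d w x z >= Rmin (gprod d w x y) (gprod d w y z) - delta.

Definition hyperbolic_group (G : Group) (S : list G) : Prop :=
  generates S /\ gromov_hyperbolic (word_dist S).

Record MetricSpace := {
  mcar :> Type;
  mdist : mcar -> mcar -> R;
  md_self : forall x, mdist x x = 0;
  md_eq : forall x y, mdist x y = 0 -> x = y;
  md_sym : forall x y, mdist x y = mdist y x;
  md_tri : forall x y z, mdist x z <= mdist x y + mdist y z }.
Arguments mdist {_} _ _.

Definition proper_space (X : MetricSpace) : Prop :=
  forall (x0 : X) (r : R) (u : nat -> X), (forall n, mdist x0 (u n) <= r) ->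
    exists phi : nat -> nat, (forall n, (phi n < phi (S n))%nat) /\
      exists l : X, forall eps, eps > 0 -> exists N, forall n, (N <= n)%nat ->
        mdist (u (phi n)) l < eps.

Definition geodesic_space (X : MetricSpace) : Prop :=
  forall x y : X, exists c : R -> X, c 0 = x /\ c (mdist x y) = y /\
    forall s t, 0 <= s <= mdist x y -> 0 <= t <= mdist x y ->
      mdist (c s) (c t) = Rabs (s - t).

Definition isometry {X : MetricSpace} (f : X -> X) : Prop :=
  (forall x y, mdist (f x) (f y) = mdist x y) /\ (forall y, exists x, f x = y).

Definition is_rep (G : Group) (X : MetricSpace) (rho : G -> X -> X) : Prop :=
  (forall g, isometry (rho g)) /\
  (forall g h x, rho (gmul g h) x = rho g (rho h x)).

Definition trans_len {X : MetricSpace} (f : X -> X) : R :=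
  real (Glb_Rbar (fun r => exists x : X, r = mdist x (f x))).

(* CV g : vertex g ; CE g s t : point at parameter t ∈ (0,1) on edge from g to g s *)
Inductive cpt (G : Group) : Type :=
  | CV (g : G)
  | CE (g s : G) (t : R).
Arguments CV {_} _.
Arguments CE {_} _ _ _.

Definition cvalid {G : Group} (S : list G) (p : cpt G) : Prop :=
  match p with CV _ => True | CE g s t => In s S /\ 0 < t < 1 end.

Definition cends {G : Group} (p : cpt G) : list (G * R) :=
  match p with
  | CV g => [(g, 0)]
  | CE g s t => [(g, t); (gmul g s, 1 - t)]
  end.

Definition cdist {G : Group} (S : list G) (p q : cpt G) : R :=
  real (Glb_Rbar (fun r =>
    (exists u a v b, In (u, a) (cends p) /\ In (v, b) (cends q) /\
                     r = a + word_dist S u v + b) \/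
    (exists g s t t', p = CE g s t /\ q = CE g s t' /\ r = Rabs (t - t')))).

Definition cact {G : Group} (gam : G) (p : cpt G) : cpt G :=
  match p with CV g => CV (gmul gam g) | CE g s t => CE (gmul gam g) s t end.

Definition cayley_trans_len {G : Group} (S : list G) (gam : G) : R :=
  real (Glb_Rbar (fun r => exists y, cvalid S y /\ r = cdist S y (cact gam y))).

Definition cgeodesic {G : Group} (S : list G) (c : R -> cpt G) : Prop :=
  (forall t, cvalid S (c t)) /\ forall s t, cdist S (c s) (c t) = Rabs (s - t).

(* c(t) -> a^+ as t -> +oo and c(t) -> a^- as t -> -oo, where a^± ∈ ∂C_S(Γ)
   are the limits of a^{±n}; convergence at infinity via Gromov products
   based at the vertex 1. *)
Definition joins_fixpoints {G : Group} (S : list G) (a : G) (c : R -> cpt G) : Prop :=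
  (forall M, exists T N, forall t n, t >= T -> (N <= n)%nat ->
      gprod (cdist S) (CV gone) (c t) (CV (gpow a n)) >= M) /\
  (forall M, exists T N, forall t n, t <= T -> (N <= n)%nat ->
      gprod (cdist S) (CV gone) (c t) (CV (gpow (ginv a) n)) >= M).

Definition in_LS {G : Group} (S : list G) (A : G -> Prop) (c : R -> cpt G) : Prop :=
  exists a, A a /\ infinite_order a /\ cgeodesic S c /\ joins_fixpoints S a c.

(* τ is (a choice of) the orbit map τ_{ρ,x}: ρ-equivariant, τ(γ) = ρ(γ)x on
   vertices, each edge sent (at constant speed) onto a geodesic segment. *)
Definition orbit_map {G : Group} (S : list G) (X : MetricSpace) (rho : G -> X -> X)
    (x : X) (tau : cpt G -> X) : Prop :=
  (forall g, tau (CV g) = rho g x) /\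
  (forall gam p, cvalid S p -> tau (cact gam p) = rho gam (tau p)) /\
  (forall g s t t', In s S -> 0 < t < 1 -> 0 < t' < 1 ->
      mdist (tau (CE g s t)) (tau (CE g s t')) = Rabs (t - t') * mdist x (rho s x)) /\
  (forall g s t, In s S -> 0 < t < 1 ->
      mdist (rho g x) (tau (CE g s t)) = t * mdist x (rho s x) /\
      mdist (tau (CE g s t)) (rho (gmul g s) x) = (1 - t) * mdist x (rho s x)).

Definition quasi_geodesic {X : MetricSpace} (K C : R) (f : R -> X) : Prop :=
  forall s t, / K * Rabs (s - t) - C <= mdist (f s) (f t) <= K * Rabs (s - t) + C.

Definition A_stable {G : Group} (S : list G) (X : MetricSpace) (rho : G -> X -> X)
    (A : G -> Prop) : Prop :=
  exists (K C : R) (x : X) (tau : cpt G -> X),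
    1 <= K /\ 0 <= C /\ orbit_map S X rho x tau /\
    forall c, in_LS S A c -> quasi_geodesic K C (fun t => tau (c t)).

Definition A_well_displacing {G : Group} (S : list G) (X : MetricSpace)
    (rho : G -> X -> X) (A : G -> Prop) : Prop :=
  exists J B : R, 1 <= J /\ 0 <= B /\ forall a, A a ->
    / J * cayley_trans_len S a - B <= trans_len (rho a) /\
    trans_len (rho a) <= J * cayley_trans_len S a + B.

(* Main.v *)
Require Import Defs.
From Stdlib Require Import Reals List.
From Coquelicot Require Import Rbar Lub.
From Stdlib Require Import Lra Lia ZArith Wf_nat Classical ClassicalEpsilon FinFun.
Import ListNotations.

(** A loxodromic element is one whose powers stay uniformly thin at the origin; a cyclically
    shortest word of length [> 7 delta + 2] is loxodromic with [|a^n| >= n (|a| - 6 delta)], by a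
    midpoint argument and the local-to-global principle for chains.

    Stable implies well-displacing: for such an [a] in [A], the geodesics from [a^-n] to [a^n]
    subconverge to a line of [L_S(A)] passing near all [a^n]; its image is a quasi-geodesic with
    uniform constants, so [rho a] moves every point by at least [(|a| - 6 delta) / K].  Elements of
    bounded translation length are absorbed by the additive constant.

    Well-displacing implies stable: if [L_S(A)] is nonempty, [A] contains a loxodromic [b], and, since
    [Gamma] is not commensurable with [<b>], a conjugate of [b] independent of it.  Then for every
    long [w] there are [b1, b2] in a fixed finite subset of [A] such that [h = b1 w b2 w^-1] has
    translation length at least [2 |w| - C].  As [A] is normal, [h] is in [A], while [rho h] moves
    [x] by at most [2 d(x, rho(w) x) + C'].  So the orbit map is a quasi-isometric embedding of the
    whole group. *)

(** * Hyperbolic pseudometrics *)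

(** Well-displacing says nothing about elements outside [A] and controls only translation lengths,
    whereas a segment of a line of [L_S(A)] reads a word [w] that may lie outside [A] and be
    conjugate to something short. The product [b1 w b2 w^-1] cures both defects: it is made of
    conjugates of elements of [A], and it contains two copies of [w^{+-1}], so the factor 2 cancels
    against the two displacements of [rho w] in the upper bound and the multiplicative constant
    stays [J]. Which of the two independent elements is inserted depends on the direction in which
    [w] or [w^-1] leaves the identity, hence the finite choice. In the other direction, the distance
    from the powers of [a] to the limit line depends on [a]. It does no harm: displacements are
    compared along [a^n], and every additive error disappears after division by [n]. The boundary is
    never constructed; points at infinity are handled through bounded or divergent Gromov products
    of powers. *)

Lemma glb_ge (E : R -> Prop) (m : R) :
  (exists r, E r) -> (forall r, E r -> m <= r) -> m <= real (Glb_Rbar E).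
Proof.
  intros [r0 Hr0] H.
  destruct (Glb_Rbar_correct E) as [H1 H2].
  assert (Hm : Rbar_le m (Glb_Rbar E)) by (apply H2; intros r Hr; apply H; exact Hr).
  specialize (H1 _ Hr0).
  destruct (Glb_Rbar E); simpl in *; tauto.
Qed.

(** [real] sends both infinities to 0, so they must be excluded: any lower bound [m] rules out minus
    infinity, the member [r] rules out plus infinity. *)
Lemma glb_le (E : R -> Prop) (m r : R) :
  (forall r', E r' -> m <= r') -> E r -> real (Glb_Rbar E) <= r.
Proof.
  intros H Hr.
  destruct (Glb_Rbar_correct E) as [H1 H2].
  assert (Hm : Rbar_le m (Glb_Rbar E)) by (apply H2; intros r' Hr'; apply H; exact Hr').
  specialize (H1 _ Hr).
  destruct (Glb_Rbar E); simpl in *; tauto.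
Qed.

Lemma glb_attained (E : R -> Prop) (m : R) :
  E m -> (forall r, E r -> m <= r) -> real (Glb_Rbar E) = m.
Proof.
  intros Hm H. apply Rle_antisym; [ now apply (glb_le E m) | apply glb_ge; eauto ].
Qed.

Lemma archimed_nat (r : R) : exists n : nat, r <= INR n.
Proof.
  exists (Z.to_nat (up r)).
  destruct (archimed r) as [H _].
  destruct (Z_le_gt_dec 0 (up r)) as [Hz|Hz].
  - rewrite INR_IZR_INZ, Z2Nat.id by lia. lra.
  - assert (IZR (up r) <= 0) by (apply (IZR_le _ 0); lia).
    generalize (pos_INR (Z.to_nat (up r))). lra.
Qed.

(** The device that removes additive constants: they stay bounded along powers, while translation
    lengths are multiplied by [n]. *)
Lemma linear_growth_le (x y c : R) :
  (forall n : nat, INR n * y - c <= INR n * x) -> y <= x.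
Proof.
  intros H. destruct (Rle_or_lt y x) as [|Hlt]; auto.
  destruct (archimed_nat ((c + 1) / (y - x))) as [n Hn].
  specialize (H n).
  assert (c + 1 <= INR n * (y - x)).
  { apply (Rmult_le_compat_r (y - x)) in Hn; [|lra].
    unfold Rdiv in Hn. rewrite Rmult_assoc, Rinv_l in Hn; lra. }
  lra.
Qed.

Lemma fun_choice {A B : Type} (P : A -> B -> Prop) :
  (forall x, exists y, P x y) -> exists f, forall x, P x (f x).
Proof.
  intros H. exists (fun x => proj1_sig (constructive_indefinite_description _ (H x))).
  intros x. apply proj2_sig.
Qed.

Lemma pigeonhole {T : Type} (l : list T) (h : nat -> T) :
  (forall n, (n <= length l)%nat -> In (h n) l) ->
  exists i j, (i < j <= length l)%nat /\ h i = h j.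
Proof.
  intros Hin. apply NNPP. intros Hno.
  assert (Hnd : NoDup (map h (seq 0 (S (length l))))).
  { apply Injective_map_NoDup_in; [|apply seq_NoDup].
    intros i j Hi Hj Hij. apply in_seq in Hi, Hj.
    destruct (Nat.lt_trichotomy i j) as [H|[H|H]]; auto; exfalso; apply Hno.
    - exists i, j. split; [lia | auto].
    - exists j, i. split; [lia | auto]. }
  assert (Hincl : incl (map h (seq 0 (S (length l)))) l).
  { intros y Hy. apply in_map_iff in Hy. destruct Hy as [n [<- Hn]].
    apply in_seq in Hn. apply Hin. lia. }
  pose proof (NoDup_incl_length Hnd Hincl) as Hlen.
  rewrite length_map, length_seq in Hlen. lia.
Qed.

Lemma exists_least (P : nat -> Prop) :
  (exists n, P n) -> exists n, P n /\ forall m, P m -> (n <= m)%nat.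
Proof.
  intros H.
  destruct (dec_inh_nat_subset_has_unique_least_element P (fun n => classic (P n)) H)
    as [n [Hn _]]. eauto.
Qed.

(** * Gromov products, chains and discrete paths *)

Record pseudometric {T : Type} (d : T -> T -> R) : Prop := {
  pm_refl : forall x, d x x = 0;
  pm_sym : forall x y, d x y = d y x;
  pm_tri : forall x y z, d x z <= d x y + d y z }.

Definition hyperbolic_with {T : Type} (delta : R) (d : T -> T -> R) : Prop :=
  forall x y z w, gprod d w x z >= Rmin (gprod d w x y) (gprod d w y z) - delta.

Section HyperbolicPseudometric.
Context {T : Type} (d : T -> T -> R) (delta : R).
Hypothesis Hd : pseudometric d.

Lemma pm_nonneg x y : 0 <= d x y.
Proof.
  pose proof (pm_tri _ Hd x y x). rewrite (pm_refl _ Hd), (pm_sym _ Hd y x) in H. lra.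
Qed.

Lemma gprod_sym w x y : gprod d w x y = gprod d w y x.
Proof. unfold gprod. rewrite (pm_sym _ Hd x y). lra. Qed.

Lemma gprod_nonneg w x y : 0 <= gprod d w x y.
Proof.
  unfold gprod. pose proof (pm_tri _ Hd x w y). rewrite (pm_sym _ Hd w y) in H. lra.
Qed.

Lemma gprod_le_l w x y : gprod d w x y <= d w x.
Proof.
  unfold gprod. pose proof (pm_tri _ Hd y x w).
  rewrite (pm_sym _ Hd y x), (pm_sym _ Hd x w) in *. lra.
Qed.

Lemma gprod_le_r w x y : gprod d w x y <= d w y.
Proof. rewrite gprod_sym. apply gprod_le_l. Qed.

(** In the comparison tripod of [w], [x], [y], the two products are the legs at [w] and at [x],
    which together make up the side [w x]. *)
Lemma gprod_change_base w x y : gprod d w x y = d w x - gprod d x w y.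
Proof.
  unfold gprod. rewrite (pm_sym _ Hd x w), (pm_sym _ Hd y w), (pm_sym _ Hd y x). lra.
Qed.

Lemma gprod_base_lip w w' x y : gprod d w x y <= gprod d w' x y + d w w'.
Proof.
  unfold gprod.
  pose proof (pm_tri _ Hd x w' w). pose proof (pm_tri _ Hd y w' w).
  rewrite (pm_sym _ Hd w' w) in *. lra.
Qed.

Lemma gprod_lip_l w x x' y : gprod d w x y <= gprod d w x' y + d x x'.
Proof.
  unfold gprod.
  pose proof (pm_tri _ Hd x x' w). pose proof (pm_tri _ Hd x' x y).
  rewrite (pm_sym _ Hd x' x) in *. lra.
Qed.

Lemma gprod_lip_r w x y y' : gprod d w x y <= gprod d w x y' + d y y'.
Proof. rewrite !(gprod_sym w x). apply gprod_lip_l. Qed.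

Hypothesis Hdelta : 0 <= delta.
Hypothesis Hhyp : hyperbolic_with delta d.

(** The product of [y] and [z] is too large to realise the minimum in the four-point inequality, so
    the other term does. Read: if [y] and [z] point the same way and [x] points away from [z], then
    [x] points away from [y]. *)
Lemma hyp_le w x y z k :
  gprod d w x z <= k -> k + delta < gprod d w y z -> gprod d w x y <= k + delta.
Proof.
  intros H1 H2. pose proof (Hhyp x y z w) as H.
  revert H. unfold Rmin. destruct (Rle_dec _ _); lra.
Qed.

Lemma hyp_ge w x y z M :
  M <= gprod d w x y -> M <= gprod d w y z -> M - delta <= gprod d w x z.
Proof.
  intros H1 H2. pose proof (Hhyp x y z w) as H.
  revert H. unfold Rmin. destruct (Rle_dec _ _); lra.
Qed.

(** Since [x y] is long and the angle at [x] is small, changing base shows that [o] and [x] lie in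
    the same direction from [y]; hence [z], which leaves [x] at [y], leaves [o] too. The bound
    [k + delta] is reproduced, so errors do not accumulate along a chain. *)
Lemma chain_step o x y z k :
  gprod d x o y <= k + delta -> gprod d y x z <= k ->
  2 * k + 2 * delta < d x y -> gprod d y o z <= k + delta.
Proof.
  intros H1 H2 H3. rewrite gprod_sym. apply hyp_le with x.
  - rewrite gprod_sym. exact H2.
  - rewrite gprod_sym, (gprod_change_base y x o), (pm_sym _ Hd y x), (gprod_sym x y o). lra.
Qed.

Lemma chain_length o y z k :
  gprod d y o z <= k -> d o y + d y z - 2 * k <= d o z.
Proof. unfold gprod. rewrite (pm_sym _ Hd z y). lra. Qed.

(** Changing base, [p] and [q] both have with [z], seen from [y], a product close to their own
    radius; the four-point inequality passes this on to the product of [p] and [q], which bounds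
    their distance. *)
Lemma near_of_same_radius p q y z k k' e :
  gprod d p y z <= k -> gprod d q y z <= k' -> Rabs (d y p - d y q) <= e ->
  d p q <= 3 * e + 2 * k + 2 * k' + 2 * delta.
Proof.
  intros Hp Hq He.
  pose proof (gprod_nonneg p y z). pose proof (gprod_nonneg q y z).
  pose proof (gprod_change_base y p z). pose proof (gprod_change_base y q z).
  assert (- e <= d y p - d y q <= e) by (revert He; unfold Rabs; destruct (Rcase_abs _); lra).
  pose proof (hyp_ge y p z q (d y p - k - k' - e)) as HH.
  rewrite (gprod_sym y z q) in HH.
  assert (Hm : d y p - k - k' - e - delta <= gprod d y p q) by (apply HH; lra).
  unfold gprod in Hm. rewrite (pm_sym _ Hd p y), (pm_sym _ Hd q y) in Hm. lra.
Qed.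

Lemma discrete_ivt (f : nat -> R) (r e : R) :
  f O <= r -> (forall n, Rabs (f (S n) - f n) <= e) ->
  forall n, (exists j, (j <= n)%nat /\ Rabs (f j - r) <= e) \/ f n < r.
Proof.
  intros H0 He n.
  assert (0 <= e) by (eapply Rle_trans; [apply Rabs_pos | apply (He O)]).
  induction n as [|n IH].
  - destruct (Req_dec (f O) r) as [E|E]; [left|right; lra].
    exists O. split; [lia|]. rewrite E, Rminus_diag, Rabs_R0. auto.
  - destruct IH as [[j [Hj1 Hj2]]|IH]; [left; eauto|].
    destruct (Rlt_or_le (f (S n)) r) as [|Hge]; auto.
    left. exists (S n). split; [lia|].
    specialize (He n). revert He. unfold Rabs. repeat destruct (Rcase_abs _); lra.
Qed.

(** Compare [p] with the path point at the same distance from [u O]. The radii differ by at most [e]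
    if there is such a point, and by at most [2 k'] if the path ends too early; [8 k'] is
    [3 (2 k') + 2 k']. *)
Lemma near_path (u : nat -> T) (n : nat) (p : T) (e k k' : R) :
  (forall i, d (u i) (u (S i)) <= e) ->
  (forall i, (i <= n)%nat -> gprod d (u i) (u O) (u n) <= k) ->
  gprod d p (u O) (u n) <= k' ->
  exists j, (j <= n)%nat /\ d p (u j) <= 3 * e + 2 * k + 8 * k' + 2 * delta.
Proof.
  intros He Hk Hk'.
  assert (Hk0 := gprod_nonneg p (u O) (u n)).
  set (y := u O) in *.
  destruct (discrete_ivt (fun i => d y (u i)) (d y p) e) with (n := n) as [[j [Hj1 Hj2]]|Hlt].
  - unfold y. rewrite (pm_refl _ Hd). apply pm_nonneg.
  - intros i. specialize (He i).
    pose proof (pm_tri _ Hd y (u i) (u (S i))). pose proof (pm_tri _ Hd y (u (S i)) (u i)).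
    rewrite (pm_sym _ Hd (u (S i)) (u i)) in *.
    unfold Rabs. destruct (Rcase_abs _); lra.
  - exists j. split; [exact Hj1|].
    rewrite Rabs_minus_sym in Hj2.
    pose proof (near_of_same_radius _ _ _ _ _ _ _ Hk' (Hk j Hj1) Hj2). lra.
  (* The path stays below the radius of [p]; the small product at [p] says that [p] overshoots the
     end of the path by at most [2 k']. *)
  - exists n. split; [lia|].
    assert (Hx : Rabs (d y p - d y (u n)) <= 2 * k').
    { unfold gprod in Hk'. fold y in Hk'. pose proof (pm_nonneg p (u n)).
      rewrite (pm_sym _ Hd (u n) p) in Hk'.
      rewrite Rabs_right by lra. lra. }
    pose proof (near_of_same_radius _ _ _ _ _ _ _ Hk' (Hk n (le_n n)) Hx).
    pose proof (pm_nonneg (u O) (u 1%nat)). specialize (He O). lra.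
Qed.

End HyperbolicPseudometric.

(** * The word metric *)

Section GroupAlgebra.
Context {G : Group}.
Implicit Types x y z : G.

Lemma gmul_assoc x y z : gmul (gmul x y) z = gmul x (gmul y z).
Proof. symmetry; apply gmulA. Qed.

Lemma gmulKV x y : gmul (ginv x) (gmul x y) = y.
Proof. rewrite gmulA, gmulVl. apply gmul1l. Qed.

Lemma gmulVK x y : gmul x (gmul (ginv x) y) = y.
Proof. rewrite gmulA, gmulVr. apply gmul1l. Qed.

Lemma gmul_cancel_l x y z : gmul x y = gmul x z -> y = z.
Proof. intros H. rewrite <- (gmulKV x y), H. apply gmulKV. Qed.

Lemma ginv_one : ginv (@gone G) = gone.
Proof. rewrite <- (gmul1l _ (ginv gone)). apply gmulVr. Qed.

Lemma ginv_inv x : ginv (ginv x) = x.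
Proof. apply (gmul_cancel_l (ginv x)). now rewrite gmulVr, gmulVl. Qed.

Lemma ginv_mul x y : ginv (gmul x y) = gmul (ginv y) (ginv x).
Proof.
  apply (gmul_cancel_l (gmul x y)).
  now rewrite gmulVr, gmul_assoc, gmulVK, gmulVr.
Qed.

End GroupAlgebra.

Global Hint Rewrite @gmul_assoc @gmulKV @gmulVK @ginv_one @ginv_inv @ginv_mul
  gmul1l gmul1r gmulVl gmulVr : grp.
Ltac grp := autorewrite with grp; try reflexivity.

Lemma eq_mul_inv {G : Group} (x y z : G) : gmul (ginv x) y = z -> y = gmul x z.
Proof. intros <-. grp. Qed.

(** * Integer powers *)

Section Powers.
Context {G : Group}.
Implicit Types a b x : G.

Definition zpow a (k : Z) : G :=
  match k with
  | Z0 => gone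
  | Zpos p => gpow a (Pos.to_nat p)
  | Zneg p => gpow (ginv a) (Pos.to_nat p)
  end.

Lemma zpow_of_nat a n : zpow a (Z.of_nat n) = gpow a n.
Proof.
  destruct n as [|n]; [reflexivity|].
  change (zpow a (Z.of_nat (S n))) with (gpow a (Pos.to_nat (Pos.of_succ_nat n))).
  now rewrite SuccNat2Pos.id_succ.
Qed.

Lemma gpow_one n : gpow (@gone G) n = gone.
Proof. induction n as [|n IH]; simpl; [reflexivity|]. now rewrite IH, gmul1l. Qed.

Lemma zpow_opp a k : zpow a (- k) = zpow (ginv a) k.
Proof. destruct k; simpl; rewrite ?ginv_inv; reflexivity. Qed.

Lemma zpow_opp_of_nat a n : zpow a (- Z.of_nat n) = gpow (ginv a) n.
Proof. rewrite zpow_opp. apply zpow_of_nat. Qed.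

Lemma zpow_succ a k : zpow a (Z.succ k) = gmul a (zpow a k).
Proof.
  destruct (Z_le_gt_dec 0 k) as [Hk|Hk].
  - rewrite <- (Z2Nat.id k) by lia. rewrite <- Nat2Z.inj_succ, !zpow_of_nat. reflexivity.
  - replace k with (- Z.of_nat (S (Z.to_nat (- Z.succ k))))%Z by lia.
    replace (Z.succ (- Z.of_nat (S (Z.to_nat (- Z.succ k)))))
      with (- Z.of_nat (Z.to_nat (- Z.succ k)))%Z by lia.
    rewrite !zpow_opp_of_nat. simpl. now rewrite gmulVK.
Qed.

Lemma zpow_add a i j : zpow a (i + j) = gmul (zpow a i) (zpow a j).
Proof.
  induction i as [|i IH|i IH] using Z.peano_ind.
  - simpl. now rewrite gmul1l.
  - rewrite Z.add_succ_l, !zpow_succ, IH. grp.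
  - apply (gmul_cancel_l a). rewrite <- zpow_succ, gmulA, <- zpow_succ.
    now rewrite Z.succ_pred, <- Z.add_succ_l, Z.succ_pred.
Qed.

Lemma zpow_1 a : zpow a 1 = a.
Proof. simpl. apply gmul1r. Qed.

Lemma ginv_zpow a k : ginv (zpow a k) = zpow a (- k).
Proof.
  apply (gmul_cancel_l (zpow a k)). rewrite gmulVr, <- zpow_add, Z.add_opp_diag_r. reflexivity.
Qed.

Lemma zpow_sub a i j : gmul (ginv (zpow a i)) (zpow a j) = zpow a (j - i).
Proof. rewrite ginv_zpow, <- zpow_add. f_equal. lia. Qed.

Lemma zpow_conj f a k : zpow (gmul f (gmul a (ginv f))) k = gmul f (gmul (zpow a k) (ginv f)).
Proof.
  induction k as [|k IH|k IH] using Z.peano_ind.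
  - simpl. grp.
  - rewrite !zpow_succ, IH. grp.
  - apply (gmul_cancel_l (gmul f (gmul a (ginv f)))).
    rewrite <- zpow_succ, Z.succ_pred, IH.
    replace k with (Z.succ (Z.pred k)) at 1 by lia. rewrite zpow_succ. grp.
Qed.

Lemma zpow_zpow a i j : zpow (zpow a i) j = zpow a (i * j).
Proof.
  induction j as [|j IH|j IH] using Z.peano_ind.
  - now rewrite Z.mul_0_r.
  - rewrite zpow_succ, IH, <- zpow_add. f_equal. lia.
  - apply (gmul_cancel_l (zpow a i)).
    rewrite <- zpow_succ, Z.succ_pred, IH, <- zpow_add. f_equal. lia.
Qed.

Lemma subgroup_gpow (A : G -> Prop) a n : subgroup A -> A a -> A (gpow a n).
Proof. intros [H1 [H2 H3]] Ha. induction n; simpl; auto. Qed.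

Lemma characteristic_conj (A : G -> Prop) f a :
  characteristic A -> A a -> A (gmul f (gmul a (ginv f))).
Proof.
  intros [_ H] Ha. apply (H (fun g => gmul f (gmul g (ginv f)))); auto.
  split; [|split].
  - intros x y. grp.
  - intros x y Hxy. apply gmul_cancel_l in Hxy.
    rewrite <- (gmul1r _ x), <- (gmul1r _ y), <- (gmulVl _ f), !gmulA.
    rewrite <- !gmulA in *.
    transitivity (gmul (gmul x (ginv f)) f); [grp|]. rewrite Hxy. grp.
  - intros y. exists (gmul (ginv f) (gmul y f)). grp.
Qed.

End Powers.

Section WordMetric.
Context {G : Group} (S : list G).
Hypothesis HS : generates S.
Notation d := (word_dist S).
Implicit Types g h : G.

Lemma word_eval_app (w w' : list (G * bool)) :
  word_eval (w ++ w') = gmul (word_eval w) (word_eval w').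
Proof.
  induction w as [|p w IH]; simpl; [now rewrite gmul1l|]. rewrite IH. grp.
Qed.

Definition word_inv (w : list (G * bool)) : list (G * bool) :=
  rev (map (fun p => (fst p, negb (snd p))) w).

Lemma word_inv_eval (w : list (G * bool)) : word_eval (word_inv w) = ginv (word_eval w).
Proof.
  induction w as [|[s b] w IH]; simpl; [now rewrite ginv_one|].
  unfold word_inv in *. simpl. rewrite word_eval_app, IH. simpl.
  destruct b; simpl; grp.
Qed.

Lemma word_inv_is_word (w : list (G * bool)) : is_word S w -> is_word S (word_inv w).
Proof.
  unfold is_word, word_inv. intros H. apply Forall_rev, Forall_map. exact H.
Qed.

Lemma word_dist_le g h w :
  is_word S w -> word_eval w = gmul (ginv g) h -> d g h <= INR (length w).
Proof.
  intros H1 H2. apply glb_le with 0; [|eauto].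
  intros r (w' & _ & _ & ->). apply pos_INR.
Qed.

(** Word lengths are natural numbers, so the infimum is a minimum. *)
Lemma word_dist_attained g h : exists w,
  is_word S w /\ word_eval w = gmul (ginv g) h /\ d g h = INR (length w).
Proof.
  destruct (exists_least (fun n => exists w,
    is_word S w /\ word_eval w = gmul (ginv g) h /\ length w = n))
    as [n [[w (Hw1 & Hw2 & Hw3)] Hmin]].
  { destruct (HS (gmul (ginv g) h)) as [w [Hw1 Hw2]]. eauto. }
  exists w. repeat split; auto.
  apply glb_attained; [eauto|].
  intros r (w' & H1 & H2 & ->). apply le_INR. rewrite Hw3. apply Hmin. eauto.
Qed.

Lemma word_dist_left x g h : d (gmul x g) (gmul x h) = d g h.
Proof.
  unfold word_dist. replace (gmul (ginv (gmul x g)) (gmul x h)) with (gmul (ginv g) h); auto.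
  grp.
Qed.

Lemma word_dist_pm : pseudometric d.
Proof.
  assert (Hs : forall x y, d x y <= d y x).
  { intros x y. destruct (word_dist_attained y x) as (w & H1 & H2 & ->).
    replace (length w) with (length (word_inv w))
      by (unfold word_inv; now rewrite length_rev, length_map).
    apply word_dist_le; [now apply word_inv_is_word|].
    rewrite word_inv_eval, H2. grp. }
  split.
  - intros x. apply Rle_antisym.
    + apply (word_dist_le x x []); [constructor|]. simpl. grp.
    + destruct (word_dist_attained x x) as (w & _ & _ & ->). apply pos_INR.
  - intros x y. apply Rle_antisym; auto.
  - intros x y z.
    destruct (word_dist_attained x y) as (w & H1 & H2 & ->).
    destruct (word_dist_attained y z) as (w' & H1' & H2' & ->).
    rewrite <- plus_INR, <- length_app. apply word_dist_le.
    + apply Forall_app. auto.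
    + rewrite word_eval_app, H2, H2'. grp.
Qed.

Lemma word_dist_one g h : d g h = d gone (gmul (ginv g) h).
Proof. rewrite <- (word_dist_left (ginv g) g h). now rewrite gmulVl. Qed.

Lemma word_dist_inv g : d gone (ginv g) = d gone g.
Proof.
  rewrite (pm_sym _ word_dist_pm gone g), (word_dist_one g). now rewrite gmul1r.
Qed.

Lemma gprod_left x w g h : gprod d (gmul x w) (gmul x g) (gmul x h) = gprod d w g h.
Proof. unfold gprod. now rewrite !word_dist_left. Qed.

Lemma word_dist_nat g h : exists n, d g h = INR n.
Proof. destruct (word_dist_attained g h) as (w & _ & _ & ->). eauto. Qed.

Lemma word_dist_generator g s : In s S -> d g (gmul g s) <= 1.
Proof.
  intros Hs. apply (word_dist_le _ _ [(s, false)]).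
  - repeat constructor. exact Hs.
  - simpl. grp.
Qed.

(** The single letter may be inverted, while an edge [CE g s t] is oriented by its generator; hence
    the two cases. *)
Lemma word_dist_eq_1 g h : d g h = 1 ->
  exists s, In s S /\ (h = gmul g s \/ g = gmul h s).
Proof.
  destruct (word_dist_attained g h) as (w & H1 & H2 & ->). intros Hl.
  apply (INR_eq _ 1) in Hl.
  destruct w as [|[s b] [|? ?]]; simpl in Hl; try discriminate.
  exists s. split; [now inversion H1|].
  simpl in H2. rewrite gmul1r in H2.
  destruct b; simpl in H2; [right|left].
  - apply (f_equal ginv) in H2. autorewrite with grp in H2. subst s. grp.
  - subst s. grp.
Qed.

(** The vertices are the prefixes of a shortest word. Subwords bound the distances from above, and
    the bounds on three consecutive pieces add up to [d g h], which forces equality. Past [n] the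
    path is constant, so the step bound holds for every [i]. *)
Lemma exists_geodesic_path g h : exists (n : nat) (u : nat -> G),
  d g h = INR n /\ u O = g /\ u n = h /\ (forall i, d (u i) (u (Datatypes.S i)) <= 1) /\
  (forall i j, (i <= n)%nat -> (j <= n)%nat -> d (u i) (u j) = Rabs (INR i - INR j)).
Proof.
  destruct (word_dist_attained g h) as (w & H1 & H2 & Hl).
  set (u := fun i => gmul g (word_eval (firstn i w))).
  assert (Hsub : forall i m, exists v, is_word S v /\ (length v <= m)%nat /\
     word_eval v = gmul (ginv (u i)) (u (i + m)%nat)).
  { intros i m. exists (firstn m (skipn i w)). split; [|split].
    - apply Forall_forall. intros p Hp. unfold is_word in H1. rewrite Forall_forall in H1.
      apply H1. rewrite <- (firstn_skipn i w). apply in_or_app. right.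
      rewrite <- (firstn_skipn m (skipn i w)). apply in_or_app. now left.
    - apply firstn_le_length.
    - unfold u. rewrite <- (firstn_skipn i (firstn (i + m) w)).
      rewrite firstn_firstn, Nat.min_l by lia.
      rewrite skipn_firstn_comm, word_eval_app.
      replace (i + m - i)%nat with m by lia. grp. }
  assert (Hle : forall i m, d (u i) (u (i + m)%nat) <= INR m).
  { intros i m. destruct (Hsub i m) as (v & Hv1 & Hv2 & Hv3).
    eapply Rle_trans; [apply (word_dist_le _ _ v); auto | now apply le_INR]. }
  assert (Hu0 : u O = g) by (unfold u; simpl; now rewrite gmul1r).
  assert (Hun : u (length w) = h).
  { unfold u. rewrite firstn_all, H2. grp. }
  assert (Hlt : forall i j, (i <= j)%nat -> (j <= length w)%nat -> d (u i) (u j) = INR j - INR i).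
  { intros i j Hij Hj. apply Rle_antisym.
    - replace j with (i + (j - i))%nat at 1 by lia. rewrite <- minus_INR by lia. apply Hle.
    - pose proof (Hle O i) as A1. pose proof (Hle j (length w - j)%nat) as A2.
      simpl in A1. replace (j + (length w - j))%nat with (length w) in A2 by lia.
      rewrite minus_INR in A2 by lia. rewrite Hu0 in A1. rewrite Hun in A2.
      pose proof (pm_tri _ word_dist_pm g (u i) h).
      pose proof (pm_tri _ word_dist_pm (u i) (u j) h). lra. }
  exists (length w), u. repeat split; auto.
  - intros i. replace (Datatypes.S i) with (i + 1)%nat by lia. apply Hle.
  - intros i j Hi Hj. destruct (Nat.le_ge_cases i j) as [H|H].
    + rewrite Hlt by auto. apply le_INR in H. unfold Rabs. destruct (Rcase_abs _); lra.
    + rewrite (pm_sym _ word_dist_pm), Hlt by auto. apply le_INR in H.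
      unfold Rabs. destruct (Rcase_abs _); lra.
Qed.

Fixpoint words_upto (n : nat) : list (list (G * bool)) :=
  match n with
  | O => [[]]
  | Datatypes.S m => [] :: flat_map (fun w => map (fun p => p :: w) (list_prod S [false; true])) (words_upto m)
  end.

Lemma words_upto_complete n w : is_word S w -> (length w <= n)%nat -> In w (words_upto n).
Proof.
  revert w. induction n as [|n IH]; intros w Hw Hl.
  - destruct w; simpl in Hl; [now left | lia].
  - destruct w as [|[s b] w]; [now left|]. right.
    inversion Hw as [|? ? Hs Hw' Heq]; subst. apply in_flat_map. exists w. split.
    + apply IH; auto. simpl in Hl. lia.
    + apply in_map_iff. exists (s, b). split; auto. apply in_prod; auto.
      destruct b; simpl; auto.
Qed.

Lemma ball_finite (r : R) : exists l : list G, forall g, d gone g <= r -> In g l.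
Proof.
  destruct (archimed_nat r) as [n Hn].
  exists (map word_eval (words_upto n)). intros g Hg.
  destruct (word_dist_attained gone g) as (w & H1 & H2 & H3).
  apply in_map_iff. exists w. split.
  - rewrite H2. grp.
  - apply words_upto_complete; auto. apply INR_le. lra.
Qed.

Lemma word_dist_gpow_le b n : d gone (gpow b n) <= INR n * d gone b.
Proof.
  induction n as [|n IH].
  - simpl. rewrite (pm_refl _ word_dist_pm). lra.
  - rewrite S_INR. simpl. pose proof (pm_tri _ word_dist_pm gone b (gmul b (gpow b n))) as H.
    rewrite (word_dist_one b (gmul b _)), gmulKV in H. lra.
Qed.

End WordMetric.

(** * Loxodromic elements *)

(** The first clause keeps the two ends of the orbit of [b] apart. By translation it says that every
    power lies almost between any earlier and any later one, which makes the powers a coarse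
    axis. *)
Definition loxodromic {G : Group} (S : list G) (b : G) : Prop :=
  (exists k, forall i j : Z, (i <= 0 <= j)%Z ->
     gprod (word_dist S) gone (zpow b i) (zpow b j) <= k) /\
  (forall M, exists N, forall n, (N <= n)%nat -> M <= word_dist S gone (gpow b n)).

Section HyperbolicGroup.
Context {G : Group} (S : list G) (delta : R).
Hypothesis HS : generates S.
Hypothesis Hdelta : 0 <= delta.
Hypothesis Hhyp : hyperbolic_with delta (word_dist S).
Notation d := (word_dist S).
Let Hd : pseudometric d := word_dist_pm S HS.
Implicit Types a b f g h u v w x y z : G.

Lemma gprod_one w g h : gprod d w g h = gprod d gone (gmul (ginv w) g) (gmul (ginv w) h).
Proof. rewrite <- (gprod_left S (ginv w) w). now rewrite gmulVl. Qed.

Lemma gpow_succ_r a n : gpow a (Datatypes.S n) = gmul (gpow a n) a.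
Proof.
  rewrite <- !zpow_of_nat, Nat2Z.inj_succ. unfold Z.succ. now rewrite zpow_add, zpow_1.
Qed.

Definition gprodl (l : list G) : G := fold_right gmul gone l.

(** The letters label a path, [u] being the letter just read. Seen from the vertex between [u] and
    [v], the path comes from [u^-1] and goes to [v]. *)
Fixpoint long_turns (k : R) u (l : list G) : Prop :=
  match l with
  | [] => True
  | v :: l' => gprod d gone (ginv u) v <= k /\ 2 * k + 2 * delta < d gone v /\ long_turns k v l'
  end.

Definition last_letter (l : list G) u : G := fold_left (fun _ v => v) l u.

(** A guaranteed length: each turn may backtrack by [k + delta] on both sides. *)
Definition total_length (k : R) (l : list G) : R :=
  fold_right (fun v acc => d gone v - 2 * k - 2 * delta + acc) 0 l.

(* The invariant of the local-to-global principle: a piecewise geodesic from [o] arriving at [y]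
   with last piece [u] makes a small angle with every admissible next piece. *)
Definition straight_at (k : R) o u y : Prop :=
  forall v, gprod d gone (ginv u) v <= k -> gprod d y o (gmul y v) <= k + delta.

Lemma straight_start k o u : straight_at k o u o.
Proof.
  intros v Hv. pose proof (gprod_nonneg _ Hd gone (ginv u) v).
  unfold gprod at 1. rewrite (pm_refl _ Hd), (pm_sym _ Hd (gmul o v) o). lra.
Qed.

Lemma straight_step k o u y v :
  straight_at k o u y -> gprod d gone (ginv u) v <= k -> 2 * k + 2 * delta < d gone v ->
  straight_at k o v (gmul y v) /\
  d o y + (d gone v - 2 * k - 2 * delta) <= d o (gmul y v).
Proof.
  intros Hs Hu Hv. specialize (Hs v Hu).
  assert (Hyv : d y (gmul y v) = d gone v).
  { rewrite (word_dist_one S y). grp. }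
  split.
  - intros w Hw. apply chain_step with y; auto.
    + rewrite gprod_one. autorewrite with grp. exact Hw.
    + lra.
  - pose proof (chain_length _ Hd _ _ _ _ Hs). lra.
Qed.

Lemma straight_list k o l u y :
  straight_at k o u y -> long_turns k u l ->
  straight_at k o (last_letter l u) (gmul y (gprodl l)) /\
  d o y + total_length k l <= d o (gmul y (gprodl l)).
Proof.
  revert u y. induction l as [|v l IH]; intros u y Hs Hl; simpl in *.
  - rewrite gmul1r. split; [exact Hs | lra].
  - destruct Hl as (H1 & H2 & H3).
    destruct (straight_step k o u y v Hs H1 H2) as [Hs' Hlen].
    destruct (IH _ _ Hs' H3) as [Hs'' Hlen''].
    rewrite gmul_assoc in *. split; [exact Hs'' | lra].
Qed.

(** The list is read cyclically: it ends with the letter [u] that was assumed to precede it, so one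
    period hands the invariant on to the next. *)
Lemma straight_powers k l u n :
  long_turns k u l -> last_letter l u = u ->
  straight_at k gone u (gpow (gprodl l) n) /\
  INR n * total_length k l <= d gone (gpow (gprodl l) n).
Proof.
  intros Hl Hu. induction n as [|n [IH1 IH2]].
  - simpl. rewrite (pm_refl _ Hd). split; [apply straight_start | lra].
  - rewrite gpow_succ_r, S_INR.
    destruct (straight_list _ _ _ _ _ IH1 Hl) as [H1 H2]. rewrite Hu in H1.
    split; [exact H1 | lra].
Qed.

Lemma small_turn_powers k a n :
  gprod d gone (ginv a) a <= k -> 2 * k + 2 * delta < d gone a ->
  gprod d gone (gpow (ginv a) n) a <= k + delta /\
  INR n * (d gone a - 2 * k - 2 * delta) <= d gone (gpow a n).
Proof.
  intros H1 H2.
  destruct (straight_powers k [a] a n) as [H3 H4]; [simpl; auto | reflexivity |].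
  unfold gprodl in *. simpl in *. rewrite gmul1r, Rplus_0_r in *. split; [|exact H4].
  specialize (H3 a H1). rewrite gprod_one in H3. autorewrite with grp in H3.
  now rewrite <- zpow_of_nat, ginv_zpow, zpow_opp_of_nat in H3.
Qed.

(** Changing base to [a], the product of [a^m] and [a] is at least [|a| - k - delta], so [a^m]
    points in the direction of [a] for [m > 0]; as [a^-n] points away from [a], it points away from
    [a^m]. This second comparison is the reason for [3 delta] instead of [2 delta]. *)
Lemma small_turn_loxodromic k a :
  gprod d gone (ginv a) a <= k -> 2 * k + 3 * delta < d gone a -> loxodromic S a.
Proof.
  intros H1 H2.
  assert (Hk := gprod_nonneg _ Hd gone (ginv a) a).
  assert (Hp : forall n, gprod d gone (gpow (ginv a) n) a <= k + delta)
    by (intros n; apply small_turn_powers; auto; lra).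
  assert (Hm : forall n, gprod d gone (gpow a n) (ginv a) <= k + delta).
  { intros n. destruct (small_turn_powers k (ginv a) n) as [H _].
    - rewrite ginv_inv, (gprod_sym _ Hd). exact H1.
    - rewrite word_dist_inv by auto. lra.
    - now rewrite ginv_inv in H. }
  split.
  - exists (k + delta + delta). intros i j [Hi Hj].
    replace i with (- Z.of_nat (Z.to_nat (- i)))%Z by lia. rewrite zpow_opp_of_nat.
    replace j with (Z.of_nat (Z.to_nat j)) by lia. rewrite zpow_of_nat.
    generalize (Z.to_nat (- i)) (Z.to_nat j). clear i j Hi Hj. intros n m.
    destruct m as [|m].
    + simpl. pose proof (gprod_le_r _ Hd gone (gpow (ginv a) n) gone).
      rewrite (pm_refl _ Hd) in *. lra.
    + apply hyp_le with a; auto.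
      rewrite (gprod_sym _ Hd), (gprod_change_base _ Hd), gprod_one.
      rewrite gmul1r. simpl. rewrite gmulKV, (gprod_sym _ Hd).
      specialize (Hm m). lra.
  - intros M. set (e := d gone a - 2 * k - 2 * delta).
    assert (He : 0 < e) by (unfold e; lra).
    destruct (archimed_nat (M / e)) as [N HN]. exists N. intros n Hn.
    destruct (small_turn_powers k a n) as [_ H]; [auto|lra|]. fold e in H.
    apply le_INR in Hn. apply Rle_trans with (2 := H).
    apply (Rmult_le_compat_r e) in HN; [|lra].
    unfold Rdiv in HN. rewrite Rmult_assoc, Rinv_l, Rmult_1_r in HN by lra.
    apply Rle_trans with (1 := HN). apply Rmult_le_compat_r; lra.
Qed.

Lemma exists_shortest_conjugate a : exists f,
  forall g, d gone (gmul (ginv f) (gmul a f)) <= d gone (gmul (ginv g) (gmul a g)).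
Proof.
  destruct (exists_least (fun n => exists f, d gone (gmul (ginv f) (gmul a f)) = INR n))
    as [n [[f Hf] Hmin]].
  { destruct (word_dist_nat S HS gone (gmul (ginv gone) (gmul a gone))) as [n Hn]. eauto. }
  exists f. intros g.
  destruct (word_dist_nat S HS gone (gmul (ginv g) (gmul a g))) as [m Hm].
  rewrite Hf, Hm. apply le_INR, Hmin. eauto.
Qed.

(* If [m] is the midpoint of [1, a], minimality gives |m^-1 a m| >= |a|, so the path m, a, am is
   geodesic at [a]; the turn of 1, a, aa at [a] is then thin. *)
Lemma shortest_conjugate_small_turn a :
  (forall g, d gone a <= d gone (gmul (ginv g) (gmul a g))) ->
  4 * delta + 1 < d gone a -> gprod d gone (ginv a) a <= 2 * delta.
Proof.
  intros Hmin Hlong.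
  destruct (exists_geodesic_path S HS gone a) as (n & u & Hn & Hu0 & Hun & _ & Hu).
  (* Both halves have length at least [(n - 1) / 2], which exceeds [2 delta]; this is where
     [4 delta + 1] comes from. *)
  set (p := (n / 2)%nat).
  assert (Hp : (p <= n - p)%nat /\ (n <= 2 * p + 1)%nat /\ (p <= n)%nat).
  { pose proof (Nat.div_mod_eq n 2). pose proof (Nat.mod_upper_bound n 2). unfold p. lia. }
  destruct Hp as (Hp1 & Hp2 & Hp3).
  apply le_INR in Hp1, Hp2. rewrite minus_INR in Hp1 by auto.
  rewrite plus_INR, mult_INR in Hp2. simpl in Hp2.
  set (m := u p).
  assert (H1m : d gone m = INR p).
  { unfold m. rewrite <- Hu0, Hu by lia. simpl. rewrite Rminus_0_l, Rabs_Ropp.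
    apply Rabs_right. pose proof (pos_INR p). lra. }
  assert (Hma : d m a = INR n - INR p).
  { unfold m. rewrite <- Hun, Hu by lia. rewrite Rabs_left1; lra. }
  assert (Hmam : INR n <= d m (gmul a m)).
  { rewrite (word_dist_one S m), <- Hn. apply Hmin. }
  assert (Haam : d a (gmul a m) = INR p).
  { rewrite (word_dist_one S a), gmulKV. exact H1m. }
  assert (Haa : d a (gmul a a) = INR n).
  { rewrite (word_dist_one S a), gmulKV. exact Hn. }
  assert (Hamaa : d (gmul a m) (gmul a a) = INR n - INR p).
  { rewrite word_dist_left. exact Hma. }
  assert (E1 : gprod d a m (gmul a m) <= 0).
  { unfold gprod. rewrite (pm_sym _ Hd (gmul a m) a). lra. }
  assert (E2 : gprod d a (gmul a a) (gmul a m) = INR p).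
  { unfold gprod. rewrite !(pm_sym _ Hd (gmul a a)), (pm_sym _ Hd (gmul a m) a). lra. }
  assert (E3 : gprod d a gone m = INR n - INR p).
  { unfold gprod. lra. }
  assert (E4 : gprod d a m (gmul a a) <= 0 + delta) by (apply hyp_le with (gmul a m); auto; lra).
  rewrite (gprod_sym _ Hd) in E4.
  assert (E5 : gprod d a (gmul a a) gone <= 0 + delta + delta) by (apply hyp_le with m; auto; lra).
  rewrite (gprod_sym _ Hd), gprod_one, gmulKV, gmul1r in E5. lra.
Qed.

Lemma loxodromic_far b : loxodromic S b ->
  forall M, exists N : nat, forall k : Z, (Z.of_nat N <= Z.abs k)%Z -> M <= d gone (zpow b k).
Proof.
  intros [_ H] M. destruct (H M) as [N HN]. exists N. intros k Hk.
  assert (E : d gone (zpow b k) = d gone (zpow b (Z.abs k))).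
  { destruct (Z.abs_eq_or_opp k) as [->| ->]; auto.
    now rewrite <- ginv_zpow, word_dist_inv. }
  rewrite E. replace (Z.abs k) with (Z.of_nat (Z.to_nat (Z.abs k))) by lia.
  rewrite zpow_of_nat. apply HN. lia.
Qed.

Lemma axis_between b k :
  (forall i j : Z, (i <= 0 <= j)%Z -> gprod d gone (zpow b i) (zpow b j) <= k) ->
  forall i m j : Z, (i <= m <= j)%Z -> gprod d (zpow b m) (zpow b i) (zpow b j) <= k.
Proof.
  intros H i m j Hm. rewrite gprod_one, !zpow_sub. apply H. lia.
Qed.

Lemma axis_near b k k' p (i j : Z) :
  (forall i j : Z, (i <= 0 <= j)%Z -> gprod d gone (zpow b i) (zpow b j) <= k) ->
  (i <= j)%Z -> gprod d p (zpow b i) (zpow b j) <= k' ->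
  exists m, d p (zpow b m) <= 3 * d gone b + 2 * k + 8 * k' + 2 * delta.
Proof.
  intros Hk Hij Hp.
  destruct (near_path _ delta Hd Hhyp (fun n => zpow b (i + Z.of_nat n)) (Z.to_nat (j - i)) p
    (d gone b) k k') as [n [_ Hn]].
  - intros n. rewrite (word_dist_one S), zpow_sub.
    replace (i + Z.of_nat (Datatypes.S n) - (i + Z.of_nat n))%Z with 1%Z by lia.
    rewrite zpow_1. lra.
  - intros n Hn. apply axis_between; auto. lia.
  - simpl. rewrite Z.add_0_r. replace (i + Z.of_nat (Z.to_nat (j - i)))%Z with j by lia. exact Hp.
  - eauto.
Qed.

Lemma loxodromic_infinite_order b : loxodromic S b -> infinite_order b.
Proof.
  intros [_ H] n Hn Hone. destruct (H 1) as [N HN].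
  assert (E : gpow b (n * N) = gone).
  { rewrite <- zpow_of_nat, Nat2Z.inj_mul, <- zpow_zpow, !zpow_of_nat, Hone. apply gpow_one. }
  specialize (HN (n * N)%nat). rewrite E, (pm_refl _ Hd) in HN.
  assert (Hle : (N <= n * N)%nat) by nia. specialize (HN Hle). lra.
Qed.

End HyperbolicGroup.

(** * Independent loxodromic elements *)

Lemma reduced_repeat (x : bool * bool) n l :
  reduced (x :: l) -> reduced (repeat x (S n) ++ l).
Proof.
  intros H. induction n as [|n IH]; [exact H|].
  change (repeat x (S (S n)) ++ l) with (x :: repeat x (S n) ++ l).
  change (repeat x (S n) ++ l) with (x :: repeat x n ++ l) in *.
  split; [intros [_ E]; now apply E | exact IH].
Qed.

Lemma word_eval_repeat {G : Group} (x : G * bool) n :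
  word_eval (repeat x n) = gpow (if snd x then ginv (fst x) else fst x) n.
Proof. induction n as [|n IH]; simpl; congruence. Qed.

Section Independence.
Context {G : Group} (S : list G) (delta : R).
Hypothesis HS : generates S.
Hypothesis Hdelta : 0 <= delta.
Hypothesis Hhyp : hyperbolic_with delta (word_dist S).
Notation d := (word_dist S).
Let Hd : pseudometric d := word_dist_pm S HS.
Implicit Types a b f g h u v w x y z : G.

(** For large [n], [f b^{pn}] and [f b^{-pn}] are at distance [|f|] from [b^{qn}] and [b^{-qn}]. As
    [f] lies between the former, it lies between the latter up to [2 delta], hence near the axis.
    The bound depends neither on [f] nor on [p] and [q]. *)
Lemma commensurating_near_axis b k f (p q : Z) :
  (forall i j : Z, (i <= 0 <= j)%Z -> gprod d gone (zpow b i) (zpow b j) <= k) ->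
  loxodromic S b -> p <> 0%Z -> gmul f (gmul (zpow b p) (ginv f)) = zpow b q ->
  exists m, d f (zpow b m) <= 3 * d gone b + 2 * k + 8 * (k + delta + delta) + 2 * delta.
Proof.
  intros Hk Hb. revert p q.
  assert (Hpos : forall p q, (0 <= q)%Z -> p <> 0%Z ->
     gmul f (gmul (zpow b p) (ginv f)) = zpow b q ->
     exists m, d f (zpow b m) <= 3 * d gone b + 2 * k + 8 * (k + delta + delta) + 2 * delta).
  { intros p q Hq Hp E.
    assert (En : forall n, gmul f (zpow b (p * n)) = gmul (zpow b (q * n)) f).
    { intros n. rewrite <- !zpow_zpow, <- E, zpow_conj. grp. }
    destruct (loxodromic_far S HS b Hb (d gone f + k + delta + delta + 1)) as [N HN].
    set (n := Z.of_nat N).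
    assert (Hclose : forall n, d (gmul f (zpow b (p * n))) (zpow b (q * n)) = d gone f).
    { intros i. rewrite En, (pm_sym _ Hd), (word_dist_one S). grp. }
    assert (Hbig : forall i, (Z.of_nat N <= Z.abs (p * i))%Z ->
        k + delta + delta < gprod d f (gmul f (zpow b (p * i))) (zpow b (q * i))).
    { intros i Hi. specialize (HN _ Hi). specialize (Hclose i).
      set (z' := gmul f (zpow b (p * i))) in *. set (z := zpow b (q * i)) in *.
      assert (Hz' : d z' f = d gone (zpow b (p * i))).
      { rewrite (pm_sym _ Hd). unfold z'. rewrite (word_dist_one S). grp. }
      pose proof (pm_tri _ Hd z' z f). unfold gprod. lra. }
    assert (B1 : k + delta + delta < gprod d f (gmul f (zpow b (p * n))) (zpow b (q * n))) by (apply Hbig; nia).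
    assert (B2 : k + delta + delta < gprod d f (gmul f (zpow b (p * - n))) (zpow b (q * - n))) by (apply Hbig; nia).
    assert (B0 : gprod d f (gmul f (zpow b (p * - n))) (gmul f (zpow b (p * n))) <= k).
    { rewrite (gprod_one S). autorewrite with grp.
      destruct (Z_le_gt_dec 0 p).
      - apply Hk. nia.
      - rewrite (gprod_sym _ Hd). apply Hk. nia. }
    apply axis_near with (i := (q * - n)%Z) (j := (q * n)%Z); auto; [nia|].
    rewrite (gprod_sym _ Hd).
    apply hyp_le with (z := gmul f (zpow b (p * - n))); auto.
    - rewrite (gprod_sym _ Hd).
      apply hyp_le with (z := gmul f (zpow b (p * n))); auto.
      rewrite (gprod_sym _ Hd). lra.
    - rewrite (gprod_sym _ Hd). lra. }
  intros p q Hp E. destruct (Z_le_gt_dec 0 q) as [Hq|Hq]; [eauto|].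
  apply (Hpos (- p)%Z (- q)%Z); [lia | lia |].
  rewrite <- !ginv_zpow, <- E. grp.
Qed.

(** A large product makes the axes of [b] and its translate by [f] run together so long that more
    points [f b^{sn}] than a ball of radius [D] has elements lie within [D] of powers [b^m]. Two of
    the differences [b^-m f b^{sn}] then agree, and cancelling gives the relation. *)
Lemma unbounded_gprod_commensurates b f :
  loxodromic S b ->
  ~ (exists M, forall i j, gprod d gone (zpow b i) (gmul f (zpow b j)) <= M) ->
  exists p q : Z, p <> 0%Z /\ gmul f (gmul (zpow b p) (ginv f)) = zpow b q.
Proof.
  intros [[k Hk] _] Hunb.
  set (D := 3 * d gone b + 2 * k + 8 * (k + d gone f + delta) + 2 * delta).
  destruct (ball_finite S HS D) as [l Hl]. set (n0 := length l).
  (* The first two terms bound the length of [f b^e] for [|e| <= n0]. After moving the base to such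
     a point, the product of [b^i] and [f b^j] still exceeds [k + |f| + delta], so the point lies on
     the common stretch. *)
  set (M := d gone f + INR n0 * d gone b + k + d gone f + delta + 1).
  assert (Hex : exists i j, M < gprod d gone (zpow b i) (gmul f (zpow b j))).
  { apply NNPP. intros Hno. apply Hunb. exists M. intros i j.
    apply Rnot_lt_le. intros H. apply Hno. eauto. }
  destruct Hex as (i & j & Hij).
  assert (H0k : 0 <= k).
  { pose proof (Hk 0 0 ltac:(lia))%Z. pose proof (gprod_nonneg _ Hd gone (zpow b 0) (zpow b 0)). lra. }
  assert (Hlen : forall e : Z, (Z.abs e <= Z.of_nat n0)%Z -> d gone (gmul f (zpow b e)) <= d gone f + INR n0 * d gone b).
  { intros e He. pose proof (pm_tri _ Hd gone f (gmul f (zpow b e))) as Ht.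
    rewrite (word_dist_one S f) in Ht. autorewrite with grp in Ht.
    assert (Hz : d gone (zpow b e) <= INR n0 * d gone b).
    { apply Rle_trans with (INR (Z.to_nat (Z.abs e)) * d gone b).
      - destruct (Z_le_gt_dec 0 e) as [He0|He0].
        + rewrite Z.abs_eq by lia. rewrite <- (Z2Nat.id e) at 1 by lia.
          rewrite zpow_of_nat. now apply word_dist_gpow_le.
        + rewrite Z.abs_neq by lia. replace e with (- (- e))%Z at 1 by lia.
          rewrite <- ginv_zpow, word_dist_inv by auto.
          rewrite <- (Z2Nat.id (- e)) at 1 by lia.
          rewrite zpow_of_nat. now apply word_dist_gpow_le.
      - apply Rmult_le_compat_r; [apply (pm_nonneg _ Hd)|]. apply le_INR. lia. }
    lra. }
  assert (Hj : (Z.of_nat n0 < Z.abs j)%Z).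
  { apply Z.nle_gt. intros Hle. specialize (Hlen j Hle).
    pose proof (gprod_le_r _ Hd gone (zpow b i) (gmul f (zpow b j))).
    pose proof (pm_nonneg _ Hd gone f). unfold M in Hij. lra. }
  set (s := Z.sgn j).
  assert (Hnear : forall n : nat, exists m : Z, (n <= n0)%nat ->
     d (gmul f (zpow b (s * Z.of_nat n))) (zpow b m) <= D).
  { intros n. destruct (le_dec n n0) as [Hn|Hn]; [|exists 0%Z; tauto].
    set (e := (s * Z.of_nat n)%Z). set (p := gmul f (zpow b e)).
    assert (He : (Z.abs e <= Z.of_nat n0)%Z) by (unfold e, s; nia).
    assert (E1 : gprod d p f (gmul f (zpow b j)) <= k).
    { unfold p. replace f with (gmul f (zpow b 0)) at 2 by apply gmul1r.
      rewrite (gprod_left S).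
      destruct (Z_le_gt_dec 0 j) as [Hj0|Hj0].
      - apply axis_between; auto. unfold e, s. rewrite Z.sgn_pos by lia. lia.
      - rewrite (gprod_sym _ Hd). apply axis_between; auto. unfold e, s.
        rewrite Z.sgn_neg by lia. lia. }
    assert (E2 : gprod d p gone (gmul f (zpow b j)) <= k + d gone f).
    { pose proof (gprod_lip_l _ Hd p gone f (gmul f (zpow b j))). lra. }
    assert (E3 : gprod d p gone (zpow b i) <= k + d gone f + delta).
    { apply hyp_le with (z := gmul f (zpow b j)); auto.
      pose proof (gprod_base_lip _ Hd gone p (zpow b i) (gmul f (zpow b j))).
      specialize (Hlen e He). fold p in Hlen. unfold M in Hij. lra. }
    change gone with (zpow b 0) in E3.
    destruct (Z_le_gt_dec 0 i) as [Hi|Hi].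
    - destruct (axis_near S delta HS Hhyp b k _ p 0%Z i Hk Hi E3) as [m Hm]. exists m. auto.
    - rewrite (gprod_sym _ Hd) in E3. assert (Hi' : (i <= 0)%Z) by lia.
      destruct (axis_near S delta HS Hhyp b k _ p i 0%Z Hk Hi' E3) as [m Hm]. exists m. auto. }
  apply fun_choice in Hnear. destruct Hnear as [m Hm].
  destruct (pigeonhole l (fun n => gmul (ginv (zpow b (m n))) (gmul f (zpow b (s * Z.of_nat n)))))
    as (n1 & n2 & Hn & E).
  { intros n Hn. apply Hl. rewrite <- (word_dist_one S), (pm_sym _ Hd). now apply Hm. }
  exists (s * Z.of_nat n1 - s * Z.of_nat n2)%Z, (m n1 - m n2)%Z. split.
  - unfold s. nia.
  - apply eq_mul_inv in E.
    unfold Z.sub. rewrite !zpow_add, <- !ginv_zpow.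
    transitivity (gmul (gmul f (zpow b (s * Z.of_nat n1))) (ginv (gmul f (zpow b (s * Z.of_nat n2))))); [grp|].
    rewrite E. grp.
Qed.

(** Otherwise every [f] commensurates [b], so the whole group lies within [D] of the powers of [b].
    By pigeonhole each element then has a nontrivial power among them, and powers of two free
    generators would commute. *)
Lemma exists_independent_translate b :
  non_elementary G -> loxodromic S b ->
  exists f k, forall i j, gprod d gone (zpow b i) (gmul f (zpow b j)) <= k.
Proof.
  intros (u & v & Hfree) Hb. apply NNPP. intros Hno.
  destruct (Hb) as [[k Hk] _].
  set (D := 3 * d gone b + 2 * k + 8 * (k + delta + delta) + 2 * delta).
  assert (Hnear : forall f, exists m, d f (zpow b m) <= D).
  { intros f. destruct (unbounded_gprod_commensurates b f Hb) as (p & q & Hp & E).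
    - intros [M HM]. apply Hno. eauto.
    - now apply commensurating_near_axis with p q. }
  apply fun_choice in Hnear. destruct Hnear as [m Hm].
  destruct (ball_finite S HS D) as [l Hl].
  assert (Hpow : forall x, exists p q, gpow x (Datatypes.S p) = zpow b q).
  { intros x.
    destruct (pigeonhole l (fun n => gmul (ginv (zpow b (m (gpow x n)))) (gpow x n)))
      as (n1 & n2 & Hn & E).
    { intros n _. apply Hl. rewrite <- (word_dist_one S), (pm_sym _ Hd). apply Hm. }
    exists (n2 - n1 - 1)%nat, (m (gpow x n2) - m (gpow x n1))%Z.
    unfold Z.sub. rewrite zpow_add, <- ginv_zpow.
    replace (Datatypes.S (n2 - n1 - 1)) with (n2 - n1)%nat by lia.
    rewrite <- zpow_of_nat, Nat2Z.inj_sub by lia. unfold Z.sub.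
    rewrite zpow_add, <- ginv_zpow, !zpow_of_nat.
    symmetry in E. apply eq_mul_inv in E. rewrite E at 1. grp. }
  destruct (Hpow u) as (p & m1 & Ep). destruct (Hpow v) as (q & m2 & Eq).
  (* The commutator of the powers of [u] and [v] that are powers of [b]: reduced, nonempty and
     trivial. *)
  apply (Hfree (repeat (false, false) (Datatypes.S p) ++ repeat (true, false) (Datatypes.S q) ++
     repeat (false, true) (Datatypes.S p) ++ repeat (true, true) (Datatypes.S q) ++ [])).
  - discriminate.
  - apply reduced_repeat. split; [intros [E _]; discriminate|]. 
    apply (reduced_repeat (true, false)). split; [intros [E _]; discriminate|].
    apply (reduced_repeat (false, true)). split; [intros [E _]; discriminate|].
    apply (reduced_repeat (true, true)). exact I.
  - rewrite app_nil_r, !map_app, !map_repeat, !word_eval_app, !word_eval_repeat. cbv [fst snd].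
    rewrite Ep, Eq, <- (zpow_opp_of_nat u), <- (zpow_opp_of_nat v), <- !ginv_zpow, !zpow_of_nat, Ep, Eq.
    rewrite !ginv_zpow, <- !zpow_add.
    replace (m1 + (m2 + (- m1 + - m2)))%Z with 0%Z by lia. reflexivity.
Qed.

(** The pair is [b^N] and [f b^N f^-1]. The bound on the products holds for all exponents, so [k] is
    fixed before [M], and the lengths can then be made large compared with [k]. *)
Lemma exists_independent_pair (A : G -> Prop) b :
  non_elementary G -> characteristic A -> A b -> loxodromic S b ->
  exists k, forall M, exists b1 b2, A b1 /\ A b2 /\ M <= d gone b1 /\ M <= d gone b2 /\
    forall c1 c2, c1 = b1 \/ c1 = ginv b1 -> c2 = b2 \/ c2 = ginv b2 -> gprod d gone c1 c2 <= k.
Proof.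
  intros Hne HA HAb Hb.
  destruct (exists_independent_translate b Hne Hb) as (f & k & Hf).
  exists (k + d gone f). intros M.
  destruct (proj2 Hb (M + 2 * d gone f)) as [N HN]. specialize (HN N (le_n N)).
  exists (gpow b N), (gmul f (gmul (gpow b N) (ginv f))).
  assert (HAN : A (gpow b N)) by (apply subgroup_gpow; auto; apply HA).
  assert (Hf0 := pm_nonneg _ Hd gone f).
  repeat split; auto.
  - now apply characteristic_conj.
  - lra.
  - pose proof (pm_tri _ Hd gone (ginv f) (gpow b N)) as T1.
    pose proof (pm_tri _ Hd gone (gmul f (gmul (gpow b N) (ginv f))) (gmul f (gpow b N))) as T2.
    pose proof (pm_tri _ Hd (ginv f) gone (gpow b N)) as T3.
    rewrite (word_dist_one S (gmul f (gmul _ _))) in T2. autorewrite with grp in T2.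
    pose proof (word_dist_one S (ginv f) (gpow b N)) as T4. autorewrite with grp in T4.
    pose proof (pm_tri _ Hd gone (ginv f) (gpow b N)) as T5.
    rewrite (word_dist_inv S HS) in T5. lra.
  - intros c1 c2 Hc1 Hc2.
    assert (E1 : exists i, c1 = zpow b i).
    { destruct Hc1 as [->| ->]; [exists (Z.of_nat N)|exists (- Z.of_nat N)%Z];
        rewrite <- ?ginv_zpow, zpow_of_nat; reflexivity. }
    assert (E2 : exists j, c2 = gmul f (gmul (zpow b j) (ginv f))).
    { destruct Hc2 as [->| ->]; [exists (Z.of_nat N)|exists (- Z.of_nat N)%Z];
        rewrite <- ?ginv_zpow, zpow_of_nat; grp. }
    destruct E1 as [i ->], E2 as [j ->].
    pose proof (gprod_lip_r _ Hd gone (zpow b i) (gmul f (gmul (zpow b j) (ginv f))) (gmul f (zpow b j))) as H.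
    rewrite (word_dist_one S (gmul f (gmul _ _))) in H. autorewrite with grp in H.
    specialize (Hf i j). lra.
Qed.

(* By the choice of [b] and [b'], pointing away from [w^{+-1}], the bi-infinite path labelled by
   [b w b' w^-1] is a local quasi-geodesic. *)
Lemma exists_long_twisted_product (A : G -> Prop) b0 :
  non_elementary G -> characteristic A -> A b0 -> loxodromic S b0 ->
  exists C r, forall w, C < d gone w -> exists b b',
    d gone b <= r /\ d gone b' <= r /\ A (gmul b (gmul w (gmul b' (ginv w)))) /\
    forall n, INR n * (2 * d gone w - C) <= d gone (gpow (gmul b (gmul w (gmul b' (ginv w)))) n).
Proof.
  intros Hne HA HAb Hb.
  destruct (exists_independent_pair A b0 Hne HA HAb Hb) as [k0 Hk0].
  (* If [b1] or its inverse has with [w] a product above [k], then by [hyp_le] both [b2] and its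
     inverse have a product at most [k0 + delta] with [w]. *)
  set (k := k0 + delta).
  destruct (Hk0 (2 * k + 2 * delta + 1)) as (b1 & b2 & HA1 & HA2 & Hl1 & Hl2 & Hb12).
  assert (Hk : 0 <= k0).
  { pose proof (Hb12 b1 b2 (or_introl eq_refl) (or_introl eq_refl)).
    pose proof (gprod_nonneg _ Hd gone b1 b2). lra. }
  (* Four letters, each losing [2 k + 2 delta]. *)
  exists (8 * k + 8 * delta), (d gone b1 + d gone b2).
  pose proof (pm_nonneg _ Hd gone b1). pose proof (pm_nonneg _ Hd gone b2).
  assert (Hsel : forall w, exists b, A b /\ d gone b <= d gone b1 + d gone b2 /\
     2 * k + 2 * delta < d gone b /\ gprod d gone b w <= k /\ gprod d gone (ginv b) w <= k).
  { intros w.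
    destruct (classic (gprod d gone b1 w <= k /\ gprod d gone (ginv b1) w <= k)) as [Hy|Hn].
    - exists b1. repeat split; try tauto; lra.
    - exists b2.
      assert (Hc1 : exists c1, (c1 = b1 \/ c1 = ginv b1) /\ k < gprod d gone c1 w).
      { apply not_and_or in Hn. destruct Hn as [Hn|Hn]; apply Rnot_le_lt in Hn; eauto. }
      destruct Hc1 as (c1 & Hc1 & Hlt).
      repeat split; auto; try lra; apply hyp_le with c1; auto;
        try (rewrite (gprod_sym _ Hd); apply Hb12; auto);
        rewrite (gprod_sym _ Hd); exact Hlt. }
  intros w Hw.
  destruct (Hsel w) as (b & HAb' & Hr & Hl & Hg & Hg').
  destruct (Hsel (ginv w)) as (b' & HAb'' & Hr' & Hl' & Hh & Hh').
  exists b, b'. split; [exact Hr|]. split; [exact Hr'|]. split.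
  - apply (proj1 (proj2 (proj1 HA))); [exact HAb'|]. now apply characteristic_conj.
  - intros n.
    destruct (straight_powers S delta HS Hdelta Hhyp k [b; w; b'; ginv w] (ginv w) n) as [_ Hlen];
      [|reflexivity|].
    + simpl. rewrite ginv_inv, (word_dist_inv S HS).
      rewrite (gprod_sym _ Hd gone w b), (gprod_sym _ Hd gone (ginv w) b').
      unfold k in *. repeat split; auto; lra.
    + unfold gprodl, total_length in Hlen. simpl in Hlen. rewrite gmul1r, (word_dist_inv S HS) in Hlen.
      eapply Rle_trans; [|exact Hlen]. apply Rmult_le_compat_l; [apply pos_INR|].
      pose proof (pm_nonneg _ Hd gone b). pose proof (pm_nonneg _ Hd gone b'). lra.
Qed.

End Independence.

(** * The Cayley graph *)

(** The limit is built one coordinate at a time, keeping infinitely many [n] that agree with it so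
    far. If no next value kept infinitely many, the largest of the finitely many thresholds for the
    elements of [B k] would leave none. *)
Lemma konig {T : Type} (B : nat -> list T) (u : nat -> nat -> T) :
  (forall k, exists N, forall n, (N <= n)%nat -> In (u n k) (B k)) ->
  exists c : nat -> T, forall k N, exists n, (N <= n)%nat /\ forall j, (j < k)%nat -> u n j = c j.
Proof.
  intros HB.
  set (I := fun k (c : nat -> T) => forall N, exists n, (N <= n)%nat /\ forall j, (j < k)%nat -> u n j = c j).
  set (upd := fun (c : nat -> T) k x j => if Nat.eq_dec j k then x else c j).
  assert (Hstep : forall kc : nat * (nat -> T), exists x, I (fst kc) (snd kc) -> I (S (fst kc)) (upd (snd kc) (fst kc) x)).
  { intros [k c]. simpl. destruct (HB k) as [N0 HN0].
    destruct (classic (I k c)) as [Hk|Hk]; [|exists (u O O); tauto].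
    apply NNPP. intros Hno.
    assert (Hx : forall x, exists N, forall n, (N <= n)%nat -> (forall j, (j < k)%nat -> u n j = c j) -> u n k <> x).
    { intros x. apply NNPP. intros Hx. apply Hno. exists x. intros _ N.
      apply NNPP. intros Hn. apply Hx. exists N. intros n HNn Hj E. apply Hn.
      exists n. split; [exact HNn|]. intros j Hjk. unfold upd.
      destruct (Nat.eq_dec j k) as [->|]; auto. apply Hj. lia. }
    assert (HN : exists N, forall x, In x (B k) -> forall n, (N <= n)%nat -> (forall j, (j < k)%nat -> u n j = c j) -> u n k <> x).
    { generalize (B k). intros l. induction l as [|x l [N IH]]; [exists O; simpl; tauto|].
      destruct (Hx x) as [N' HN']. exists (max N N'). intros y [<-|Hy] n Hn.
      - apply HN'. lia.
      - apply IH; auto. lia. }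
    destruct HN as [N HN]. destruct (Hk (max N N0)) as (n & Hn & Hj).
    apply (HN (u n k)) with n; auto; [apply HN0; lia | lia]. }
  apply fun_choice in Hstep. destruct Hstep as [F HF].
  set (c := fix c k := match k with O => u O | S k' => upd (c k') k' (F (k', c k')) end).
  assert (HI : forall k, I k (c k)).
  { induction k as [|k IH].
    - intros N. exists N. split; auto. lia.
    - exact (HF (k, c k) IH). }
  assert (Hc : forall k j, (j < k)%nat -> c k j = c (S j) j).
  { induction k as [|k IH]; intros j Hj; [lia|].
    destruct (Nat.eq_dec j k) as [->|Hne]; auto.
    rewrite <- IH by lia. simpl. unfold upd at 1. destruct (Nat.eq_dec j k); tauto. }
  exists (fun j => c (S j) j). intros k N. destruct (HI k N) as (n & Hn & Hj).
  exists n. split; auto. intros j Hjk. rewrite <- (Hc k) by auto. auto.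
Qed.

Section CayleyGraph.
Context {G : Group} (S : list G).
Hypothesis HS : generates S.
Notation d := (word_dist S).
Let Hd : pseudometric d := word_dist_pm S HS.
Implicit Types a b f g h u v w x y z : G.

Definition base_vertex (p : cpt G) : G := match p with CV g => g | CE g _ _ => g end.

Lemma cends_near p u r : cvalid S p -> In (u, r) (cends p) ->
  0 <= r <= 1 /\ d (base_vertex p) u <= 1.
Proof.
  destruct p as [g|g s t]; simpl.
  - intros _ [E|[]]. inversion E; subst. rewrite (pm_refl _ Hd). lra.
  - intros [Hs Ht] [E|[E|[]]]; inversion E; subst.
    + rewrite (pm_refl _ Hd). lra.
    + split; [lra|]. now apply word_dist_generator.
Qed.

Lemma base_vertex_end p : cvalid S p -> exists r, In (base_vertex p, r) (cends p) /\ 0 <= r <= 1.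
Proof.
  destruct p as [g|g s t]; simpl; intros H; [exists 0 | exists t]; split; auto; lra.
Qed.

(** The bridge to the Cayley graph: each point is within 1 of its base vertex, so all hyperbolic
    arguments can take place on vertices. *)
Lemma cdist_bounds p q : cvalid S p -> cvalid S q ->
  d (base_vertex p) (base_vertex q) - 2 <= cdist S p q <= d (base_vertex p) (base_vertex q) + 2.
Proof.
  intros Hp Hq.
  destruct (base_vertex_end p Hp) as (r1 & Hr1 & B1).
  destruct (base_vertex_end q Hq) as (r2 & Hr2 & B2).
  assert (Hlow : forall r, (exists u (a : R) v (b : R), In (u, a) (cends p) /\ In (v, b) (cends q) /\
                     r = a + d u v + b) \/
      (exists g s t t', p = CE g s t /\ q = CE g s t' /\ r = Rabs (t - t')) ->
      d (base_vertex p) (base_vertex q) - 2 <= r).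
  { intros r [(u & a & v & b & Hu & Hv & ->)|(g & s & t & t' & -> & -> & ->)].
    - destruct (cends_near _ _ _ Hp Hu), (cends_near _ _ _ Hq Hv).
      pose proof (pm_tri _ Hd (base_vertex p) u (base_vertex q)).
      pose proof (pm_tri _ Hd u v (base_vertex q)).
      rewrite (pm_sym _ Hd v) in *. lra.
    - simpl. rewrite (pm_refl _ Hd). pose proof (Rabs_pos (t - t')). lra. }
  split.
  - apply glb_ge; [|exact Hlow]. eexists. left. repeat eexists; eauto.
  - apply Rle_trans with (r1 + d (base_vertex p) (base_vertex q) + r2); [|lra].
    eapply glb_le; [exact Hlow|]. left. repeat eexists; eauto.
Qed.

Lemma gprod_cdist_bounds p q w : cvalid S p -> cvalid S q ->
  gprod d w (base_vertex p) (base_vertex q) - 3 <= gprod (cdist S) (CV w) p q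
    <= gprod d w (base_vertex p) (base_vertex q) + 3.
Proof.
  intros Hp Hq. unfold gprod.
  pose proof (cdist_bounds p q Hp Hq).
  pose proof (cdist_bounds p (CV w) Hp I). pose proof (cdist_bounds q (CV w) Hq I).
  simpl in *. lra.
Qed.

Lemma displacement_conj a g : d g (gmul a g) = d gone (gmul (ginv g) (gmul a g)).
Proof. apply word_dist_one. Qed.

Lemma cact_valid a p : cvalid S p -> cvalid S (cact a p).
Proof. destruct p; auto. Qed.

(** The displacement of the vertex [g] is the length of [g^-1 a g]; with the next lemma, the
    translation length is the least length of a conjugate, up to 2. *)
Lemma cayley_trans_len_le a g :
  cayley_trans_len S a <= d gone (gmul (ginv g) (gmul a g)) + 2.
Proof.
  rewrite <- displacement_conj.
  apply Rle_trans with (cdist S (CV g) (cact a (CV g))).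
  - apply glb_le with (-2); [|exists (CV g); simpl; auto].
    intros r (y & Hy & ->). pose proof (cdist_bounds y (cact a y) Hy (cact_valid a y Hy)).
    pose proof (pm_nonneg _ Hd (base_vertex y) (base_vertex (cact a y))). lra.
  - apply (cdist_bounds (CV g) (CV (gmul a g))); exact I.
Qed.

Lemma cayley_trans_len_ge a m :
  (forall g, m <= d gone (gmul (ginv g) (gmul a g))) -> m - 2 <= cayley_trans_len S a.
Proof.
  intros H. apply glb_ge; [exists (cdist S (CV gone) (cact a (CV gone))), (CV gone); simpl; auto|].
  intros r (y & Hy & ->). pose proof (cdist_bounds y (cact a y) Hy (cact_valid a y Hy)).
  specialize (H (base_vertex y)). rewrite <- displacement_conj in H.
  replace (base_vertex (cact a y)) with (gmul a (base_vertex y)) in * by (destruct y; reflexivity).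
  lra.
Qed.

(** [cdist] is an infimum over routes through endpoints and, on a common edge, the direct route.
    [Hlow] shows that no candidate is below [|s - t|], and [Hatt] exhibits one equal to it. *)
Lemma line_param (c : Z -> G) :
  (forall i j, d (c i) (c j) = Rabs (IZR i - IZR j)) ->
  exists gam : R -> cpt G, cgeodesic S gam /\
    (forall k, gam (IZR k) = CV (c k)) /\
    forall t, exists k, Rabs (t - IZR k) <= 1 /\ base_vertex (gam t) = c k.
Proof.
  intros Hc.
  assert (Hedge : forall k : Z, exists e : G * bool, In (fst e) S /\
     if snd e then c k = gmul (c (k + 1)%Z) (fst e) else c (k + 1)%Z = gmul (c k) (fst e)).
  { intros k. destruct (word_dist_eq_1 S HS (c k) (c (k + 1)%Z)) as (s & Hs & [E|E]).
    - rewrite Hc, plus_IZR. replace (IZR k - (IZR k + 1)) with (- (1)) by lra.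
      rewrite Rabs_Ropp. apply Rabs_R1.
    - exists (s, false). auto.
    - exists (s, true). auto. }
  apply fun_choice in Hedge. destruct Hedge as [e He].
  assert (Hinj : forall i j, c i = c j -> i = j).
  { intros i j E. assert (E0 : d (c i) (c j) = 0) by (rewrite E; apply (pm_refl _ Hd)).
    rewrite Hc in E0. apply eq_IZR.
    revert E0. unfold Rabs. destruct (Rcase_abs _); lra. }
  (* An edge whose letter is inverted is based at its far vertex and traversed backwards, hence the
     parameter [1 - (t - k)]. *)
  set (gam := fun t => let k := Int_part t in
     if Req_EM_T t (IZR k) then CV (c k)
     else if snd (e k) then CE (c (k + 1)%Z) (fst (e k)) (1 - (t - IZR k))
     else CE (c k) (fst (e k)) (t - IZR k)).
  assert (Hint : forall k, Int_part (IZR k) = k).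
  { intros k. destruct (base_Int_part (IZR k)) as [H1 H2].
    apply le_IZR in H1. assert (H3 : IZR k < IZR (Int_part (IZR k) + 1)) by (rewrite plus_IZR; lra).
    apply lt_IZR in H3. lia. }
  assert (Hvalid : forall t, cvalid S (gam t)).
  { intros t. unfold gam. cbv zeta. destruct (base_Int_part t) as [H1 H2].
    destruct (Req_EM_T _ _) as [E|E]; [exact I|].
    destruct (He (Int_part t)) as [Hs _].
    destruct (snd (e (Int_part t))); simpl; split; auto; lra. }
  assert (Hends : forall t u r, In (u, r) (cends (gam t)) -> exists i, u = c i /\ r = Rabs (t - IZR i)).
  { intros t u r. unfold gam. cbv zeta. destruct (base_Int_part t) as [H1 H2].
    destruct (Req_EM_T _ _) as [E|E]; simpl.
    - intros [E'|[]]. inversion E'; subst. exists (Int_part t). split; auto.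
      rewrite Rabs_right; lra.
    - destruct (He (Int_part t)) as [_ Hs].
      destruct (snd (e (Int_part t))); simpl; intros [E'|[E'|[]]]; inversion E'; subst.
      + exists (Int_part t + 1)%Z. split; auto. rewrite plus_IZR, Rabs_left1; lra.
      + exists (Int_part t). split; [auto|]. rewrite Rabs_right; lra.
      + exists (Int_part t). split; [auto|]. rewrite Rabs_right; lra.
      + exists (Int_part t + 1)%Z. split; auto. rewrite plus_IZR, Rabs_left1; lra. }
  assert (Hfloor : forall t, In (c (Int_part t), t - IZR (Int_part t)) (cends (gam t))).
  { intros t. unfold gam. cbv zeta. destruct (Req_EM_T _ _) as [E|E]; simpl.
    - left. f_equal. lra.
    - destruct (He (Int_part t)) as [_ Hs].
      destruct (snd (e (Int_part t))); simpl; [right; left | left]; f_equal; auto; lra. }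
  assert (Hceil : forall t, t <> IZR (Int_part t) ->
     In (c (Int_part t + 1)%Z, 1 - (t - IZR (Int_part t))) (cends (gam t))).
  { intros t Ht. unfold gam. cbv zeta. destruct (Req_EM_T _ _) as [E|E]; [tauto|].
    destruct (He (Int_part t)) as [_ Hs].
    destruct (snd (e (Int_part t))); simpl; [left | right; left]; f_equal; auto; lra. }
  (* Here [i] and [j] are the ends in the orientation of the edge. The distances to both ends
     determine [t]; by injectivity of [c], two points with the same edge label have the same
     ends. *)
  assert (Hsame : forall t g s r, gam t = CE g s r -> exists i j, g = c i /\ gmul g s = c j /\
     (j = i + 1 \/ i = j + 1)%Z /\ r = Rabs (t - IZR i) /\ 0 < r /\ 1 - r = Rabs (t - IZR j) /\ r < 1).
  { intros t g s r. unfold gam. cbv zeta. destruct (base_Int_part t) as [H1 H2].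
    destruct (Req_EM_T _ _) as [E|E]; [discriminate|].
    destruct (He (Int_part t)) as [_ Hs].
    destruct (snd (e (Int_part t))); intros E'; inversion E'; subst.
    - exists (Int_part t + 1)%Z, (Int_part t). repeat split; auto; rewrite ?plus_IZR; try lra.
      + rewrite Rabs_left1; lra.
      + rewrite Rabs_right; lra.
    - exists (Int_part t), (Int_part t + 1)%Z. repeat split; auto; rewrite ?plus_IZR; try lra.
      + rewrite Rabs_right; lra.
      + rewrite Rabs_left1; lra. }
  set (cand := fun p q r =>
    (exists u (a : R) v (b : R), In (u, a) (cends p) /\ In (v, b) (cends q) /\ r = a + d u v + b) \/
    (exists g s t t', p = CE g s t /\ q = CE g s t' /\ r = Rabs (t - t'))).
  assert (Hlow : forall s t r, cand (gam s) (gam t) r -> Rabs (s - t) <= r).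
  { intros s t r [(u & a & v & b & Hu & Hv & ->)|(g & x & r1 & r2 & E1 & E2 & ->)].
    - destruct (Hends _ _ _ Hu) as (i & -> & ->). destruct (Hends _ _ _ Hv) as (j & -> & ->).
      rewrite Hc. unfold Rabs. repeat destruct (Rcase_abs _); lra.
    - destruct (Hsame _ _ _ _ E1) as (i & j & -> & Hj & Hij & A1 & A2 & A3 & A4).
      destruct (Hsame _ _ _ _ E2) as (i' & j' & Hi' & Hj' & _ & B1 & B2 & B3 & B4).
      apply Hinj in Hi'. subst i'. rewrite Hj in Hj'. apply Hinj in Hj'. subst j'.
      assert (Hij' : IZR j = IZR i + 1 \/ IZR i = IZR j + 1)
        by (rewrite <- !plus_IZR; destruct Hij as [->| ->]; auto).
      clear -A1 A2 A3 A4 B1 B2 B3 B4 Hij'.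
      assert (Hs : s - IZR i = (IZR j - IZR i) * r1).
      { revert A1 A3. unfold Rabs. destruct Hij' as [E|E]; rewrite E;
          repeat destruct (Rcase_abs _); nra. }
      assert (Ht : t - IZR i = (IZR j - IZR i) * r2).
      { revert B1 B3. unfold Rabs. destruct Hij' as [E|E]; rewrite E;
          repeat destruct (Rcase_abs _); nra. }
      replace (s - t) with ((IZR j - IZR i) * (r1 - r2)) by lra.
      rewrite Rabs_mult. destruct Hij' as [E|E]; rewrite E.
      + replace (IZR i + 1 - IZR i) with 1 by lra. rewrite Rabs_R1. lra.
      + replace (IZR j - (IZR j + 1)) with (- (1)) by lra. rewrite Rabs_Ropp, Rabs_R1. lra. }
  (* Unless both points are inside one edge, the route leaves [s] through the next vertex, or [s]
     itself if it is one, and reaches [t] from its integer part. *)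
  assert (Hatt : forall s t, s <= t -> cand (gam s) (gam t) (t - s)).
  { intros s t Hst.
    destruct (base_Int_part s) as [S1 S2]. destruct (base_Int_part t) as [T1 T2].
    assert (Hk : (Int_part s <= Int_part t)%Z).
    { assert (H : IZR (Int_part s) < IZR (Int_part t + 1)) by (rewrite plus_IZR; lra).
      apply lt_IZR in H. lia. }
    destruct (Req_EM_T s (IZR (Int_part s))) as [E|E].
    - left. exists (c (Int_part s)), (s - IZR (Int_part s)), (c (Int_part t)), (t - IZR (Int_part t)).
      repeat split; auto. rewrite Hc. apply IZR_le in Hk. rewrite Rabs_left1; lra.
    - destruct (Z.eq_dec (Int_part s) (Int_part t)) as [Ek|Ek].
      + right. unfold gam. cbv zeta. rewrite <- Ek in *.
        destruct (Req_EM_T s _) as [|_]; [tauto|].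
        destruct (Req_EM_T t _) as [Et|_]; [lra|].
        destruct (snd (e (Int_part s))); repeat eexists.
        * rewrite Rabs_right; lra.
        * rewrite Rabs_left1; lra.
      + left. exists (c (Int_part s + 1)%Z), (1 - (s - IZR (Int_part s))), (c (Int_part t)), (t - IZR (Int_part t)).
        repeat split; auto. rewrite Hc.
        assert (Hk' : (Int_part s + 1 <= Int_part t)%Z) by lia.
        apply IZR_le in Hk'. rewrite plus_IZR in *. rewrite Rabs_left1; lra. }
  assert (Hsym : forall p q r, cand p q r -> cand q p r).
  { intros p q r [(u & a & v & b & Hu & Hv & ->)|(g & x & r1 & r2 & -> & -> & ->)].
    - left. exists v, b, u, a. repeat split; auto. rewrite (pm_sym _ Hd). lra.
    - right. exists g, x, r2, r1. repeat split; auto. apply Rabs_minus_sym. }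
  exists gam. split; [|split].
  - split; [exact Hvalid|]. intros s t. apply glb_attained; [|apply Hlow].
    change (cand (gam s) (gam t) (Rabs (s - t))).
    destruct (Rle_or_lt s t) as [H|H].
    + rewrite Rabs_left1 by lra. replace (- (s - t)) with (t - s) by lra. auto.
    + rewrite Rabs_right by lra. apply Hsym, Hatt. lra.
  - intros k. unfold gam. cbv zeta. rewrite Hint. destruct (Req_EM_T _ _); tauto.
  - intros t. unfold gam. cbv zeta. destruct (base_Int_part t) as [H1 H2].
    destruct (Req_EM_T _ _) as [E|E]; [|destruct (snd (e (Int_part t)))]; simpl.
    + exists (Int_part t). split; auto. rewrite Rabs_right; lra.
    + exists (Int_part t + 1)%Z. split; auto. rewrite plus_IZR, Rabs_left1; lra.
    + exists (Int_part t). split; auto. rewrite Rabs_right; lra.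
Qed.

End CayleyGraph.

(** * Geodesic lines joining the fixed points *)

Section Axes.
Context {G : Group} (S : list G) (delta : R).
Hypothesis HS : generates S.
Hypothesis Hdelta : 0 <= delta.
Hypothesis Hhyp : hyperbolic_with delta (word_dist S).
Notation d := (word_dist S).
Let Hd : pseudometric d := word_dist_pm S HS.

(** Two far points on opposite sides of the line have a product bounded by [r0]. Large powers of [a]
    and of its inverse point in their respective directions, so two uses of [hyp_le] transfer the
    bound. *)
Lemma geodesic_line_loxodromic (a : G) (c : R -> cpt G) :
  cgeodesic S c -> joins_fixpoints S a c -> loxodromic S a.
Proof.
  intros [Hv Hc] [Hplus Hminus].
  set (v := fun t => base_vertex (c t)).
  assert (Hvt : forall s t, Rabs (s - t) - 2 <= d (v s) (v t) <= Rabs (s - t) + 2).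
  { intros s t. rewrite <- Hc. pose proof (cdist_bounds S HS (c s) (c t) (Hv s) (Hv t)).
    unfold v. lra. }
  assert (Hprod : forall t g, gprod (cdist S) (CV gone) (c t) (CV g) - 3 <= gprod d gone (v t) g).
  { intros t g. pose proof (gprod_cdist_bounds S HS (c t) (CV g) gone (Hv t) I).
    simpl in *. unfold v. lra. }
  split.
  - set (r0 := 3 + d gone (v 0)).
    (* Of the 4, 3 is lost between [cdist] and the word metric and 1 makes the inequality strict. *)
    destruct (Hplus (r0 + 2 * delta + 4)) as (T1 & N1 & H1).
    destruct (Hminus (r0 + 2 * delta + 4)) as (T2 & N2 & H2).
    set (t1 := Rmax T1 0). set (t2 := Rmin T2 0).
    assert (Ht1 : T1 <= t1 /\ 0 <= t1) by (split; [apply Rmax_l | apply Rmax_r]).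
    assert (Ht2 : t2 <= T2 /\ t2 <= 0) by (split; [apply Rmin_l | apply Rmin_r]).
    assert (E0 : gprod d gone (v t2) (v t1) <= r0).
    { pose proof (gprod_base_lip _ Hd gone (v 0) (v t2) (v t1)).
      assert (gprod d (v 0) (v t2) (v t1) <= 3).
      { unfold gprod. pose proof (Hvt t2 0) as A1. pose proof (Hvt t1 0) as A2.
        pose proof (Hvt t2 t1) as A3. revert A1 A2 A3. unfold Rabs.
        repeat destruct (Rcase_abs _); lra. }
      unfold r0. lra. }
    pose proof (pm_nonneg _ Hd gone a) as Ha. pose proof (pm_nonneg _ Hd gone (v 0)) as Hv0.
    pose proof (pos_INR N1) as HN1. pose proof (pos_INR N2) as HN2.
    assert (P1 := Rmult_le_pos _ _ HN1 Ha). assert (P2 := Rmult_le_pos _ _ HN2 Ha).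
    (* The last two terms cover exponents below the thresholds, where the product is bounded by the
       length of the short power. *)
    exists (r0 + 2 * delta + INR N1 * d gone a + INR N2 * d gone a). intros i j [Hi Hj].
    replace i with (- Z.of_nat (Z.to_nat (- i)))%Z by lia. rewrite zpow_opp_of_nat.
    replace j with (Z.of_nat (Z.to_nat j)) by lia. rewrite zpow_of_nat.
    generalize (Z.to_nat (- i)) (Z.to_nat j). clear i j Hi Hj. intros m n.
    destruct (le_lt_dec N1 n) as [Hn|Hn]; [destruct (le_lt_dec N2 m) as [Hm|Hm]|].
    + specialize (H1 t1 n ltac:(lra) Hn). specialize (H2 t2 m ltac:(lra) Hm).
      pose proof (Hprod t1 (gpow a n)) as A1. pose proof (Hprod t2 (gpow (ginv a) m)) as A2.
      assert (E1 : gprod d gone (v t2) (gpow a n) <= r0 + delta).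
      { apply hyp_le with (v t1); auto. rewrite (gprod_sym _ Hd). lra. }
      assert (E2 : gprod d gone (gpow a n) (gpow (ginv a) m) <= r0 + delta + delta).
      { apply hyp_le with (v t2); auto; [rewrite (gprod_sym _ Hd); exact E1|].
        rewrite (gprod_sym _ Hd). lra. }
      rewrite (gprod_sym _ Hd). lra.
    + pose proof (gprod_le_l _ Hd gone (gpow (ginv a) m) (gpow a n)).
      pose proof (word_dist_gpow_le S HS (ginv a) m) as A. rewrite (word_dist_inv S HS) in A.
      assert (INR m * d gone a <= INR N2 * d gone a).
      { apply Rmult_le_compat_r; auto. apply le_INR. lia. }
      unfold r0. lra.
    + pose proof (gprod_le_r _ Hd gone (gpow (ginv a) m) (gpow a n)).
      pose proof (word_dist_gpow_le S HS a n) as A.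
      assert (INR n * d gone a <= INR N1 * d gone a).
      { apply Rmult_le_compat_r; auto. apply le_INR. lia. }
      unfold r0. lra.
  - intros M. destruct (Hplus (M + 3)) as (T & N & H). exists N. intros n Hn.
    specialize (H T n (Rge_refl T) Hn). pose proof (Hprod T (gpow a n)).
    pose proof (gprod_le_r _ Hd gone (v T) (gpow a n)). lra.
Qed.

(** The indices are shifted so that index 0 is near the identity; only with this normalisation do
    the vertices at a fixed index stay in a finite ball. [D] is the bound of [near_path] for unit
    steps on an exact geodesic. *)
Lemma geodesic_between (g h : G) (D k : R) :
  D = 3 + 8 * k + 2 * delta -> gprod d gone g h <= k ->
  exists (v : Z -> G) (lo hi : nat), v (- Z.of_nat lo)%Z = g /\ v (Z.of_nat hi) = h /\
    (forall i j, (- Z.of_nat lo <= i <= Z.of_nat hi)%Z -> (- Z.of_nat lo <= j <= Z.of_nat hi)%Z ->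
       d (v i) (v j) = Rabs (IZR i - IZR j)) /\
    d gone (v 0%Z) <= D /\
    (forall p, gprod d p g h <= k ->
       exists j, (- Z.of_nat lo <= j <= Z.of_nat hi)%Z /\ d p (v j) <= D).
Proof.
  intros -> Hk.
  destruct (exists_geodesic_path S HS g h) as (n & u & Hn & Hu0 & Hun & Hu1 & Hu).
  assert (Hnear : forall p, gprod d p g h <= k -> exists j, (j <= n)%nat /\ d p (u j) <= 3 + 8 * k + 2 * delta).
  { intros p Hp. destruct (near_path _ delta Hd Hhyp u n p 1 0 k) as (j & Hj & Hpj).
    - exact Hu1.
    - intros i Hi. unfold gprod. rewrite !Hu by lia. apply le_INR in Hi. pose proof (pos_INR i).
      simpl. rewrite (Rabs_left1 (0 - INR i)), (Rabs_right (INR n - INR i)), (Rabs_left1 (0 - INR n)); lra.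
    - now rewrite Hu0, Hun.
    - exists j. split; auto. lra. }
  destruct (Hnear gone Hk) as (m & Hm & Hm').
  exists (fun z => u (Z.to_nat (z + Z.of_nat m))), m, (n - m)%nat.
  split; [|split; [|split; [|split]]].
  - now replace (Z.to_nat (- Z.of_nat m + Z.of_nat m)) with O by lia.
  - now replace (Z.to_nat (Z.of_nat (n - m) + Z.of_nat m)) with n by lia.
  - intros i j Hi Hj. rewrite Hu by lia. rewrite !INR_IZR_INZ, !Z2Nat.id by lia.
    rewrite !plus_IZR. f_equal. lra.
  - now replace (Z.to_nat (0 + Z.of_nat m)) with m by lia.
  - intros p Hp. destruct (Hnear p Hp) as (j & Hj & Hpj).
    exists (Z.of_nat j - Z.of_nat m)%Z. split; [lia|].
    now replace (Z.to_nat (Z.of_nat j - Z.of_nat m + Z.of_nat m)) with j by lia.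
Qed.

(** For [n <= m], changing base to the [n]-th power gives its length minus a product at most [k]. *)
Lemma powers_gprod_large (a : G) : loxodromic S a ->
  forall M, exists N : nat, forall e : Z, (e = 1 \/ e = -1)%Z -> forall n m : nat, (N <= n)%nat -> (N <= m)%nat ->
    M <= gprod d gone (zpow a (e * Z.of_nat n)) (zpow a (e * Z.of_nat m)).
Proof.
  intros Ha M. destruct (Ha) as [[k Hk] _].
  destruct (loxodromic_far S HS a Ha (M + k)) as [N HN]. exists N.
  assert (Hle : forall e : Z, (e = 1 \/ e = -1)%Z -> forall n m : nat, (N <= n)%nat -> (n <= m)%nat ->
    M <= gprod d gone (zpow a (e * Z.of_nat n)) (zpow a (e * Z.of_nat m))).
  { intros e He n m Hn Hnm. rewrite (gprod_change_base _ Hd).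
    specialize (HN (e * Z.of_nat n)%Z ltac:(destruct He; subst; lia)).
    assert (gprod d (zpow a (e * Z.of_nat n)) (zpow a 0) (zpow a (e * Z.of_nat m)) <= k).
    { destruct He as [->| ->]; [|rewrite (gprod_sym _ Hd)]; apply (axis_between S); auto; lia. }
    simpl in H. lra. }
  intros e He n m Hn Hm. destruct (Nat.le_ge_cases n m) as [H|H]; auto.
  rewrite (gprod_sym _ Hd). auto.
Qed.

Lemma exists_axis_line (a : G) : loxodromic S a ->
  exists c : Z -> G,
    (forall i j, d (c i) (c j) = Rabs (IZR i - IZR j)) /\
    (forall e, (e = 1 \/ e = -1)%Z -> forall M, exists (K : Z) (N : nat), forall z n,
       (K <= e * z)%Z -> (N <= n)%nat -> M <= gprod d gone (c z) (zpow a (e * Z.of_nat n))) /\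
    (exists D, forall n, exists z, d (gpow a n) (c z) <= D).
Proof.
  intros Ha. destruct (Ha) as [[k Hk] _].
  set (D := 3 + 8 * k + 2 * delta).
  assert (Hseg : forall n : nat, exists s : (Z -> G) * (nat * nat),
    let v := fst s in let lo := fst (snd s) in let hi := snd (snd s) in
    v (- Z.of_nat lo)%Z = zpow a (- Z.of_nat n) /\ v (Z.of_nat hi) = zpow a (Z.of_nat n) /\
    (forall i j, (- Z.of_nat lo <= i <= Z.of_nat hi)%Z -> (- Z.of_nat lo <= j <= Z.of_nat hi)%Z ->
       d (v i) (v j) = Rabs (IZR i - IZR j)) /\
    d gone (v 0%Z) <= D /\
    (forall p, gprod d p (zpow a (- Z.of_nat n)) (zpow a (Z.of_nat n)) <= k ->
       exists j, (- Z.of_nat lo <= j <= Z.of_nat hi)%Z /\ d p (v j) <= D)).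
  { intros n. destruct (geodesic_between (zpow a (- Z.of_nat n)) (zpow a (Z.of_nat n)) D k) as (v & lo & hi & H).
    - reflexivity.
    - apply Hk. lia.
    - exists (v, (lo, hi)). exact H. }
  apply fun_choice in Hseg. destruct Hseg as [s Hs]. cbv zeta in Hs.
  set (v := fun n => fst (s n)) in *. set (lo := fun n => fst (snd (s n))) in *.
  set (hi := fun n => snd (snd (s n))) in *.
  (* The endpoints [a^{+-n}] go to infinity while index 0 stays within [D] of the identity, so both
     halves grow. *)
  assert (Hlong : forall m : nat, exists N, forall n, (N <= n)%nat -> (m <= lo n)%nat /\ (m <= hi n)%nat).
  { intros m. destruct (loxodromic_far S HS a Ha (INR m + D)) as [N HN]. exists N. intros n Hn.
    destruct (Hs n) as (H1 & H2 & H3 & H4 & _). fold (v n) (lo n) (hi n) in *.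
    pose proof (HN (- Z.of_nat n)%Z ltac:(lia)) as L1. pose proof (HN (Z.of_nat n) ltac:(lia)) as L2.
    rewrite <- H1 in L1. rewrite <- H2 in L2.
    pose proof (pm_tri _ Hd gone (v n 0%Z) (v n (- Z.of_nat (lo n))%Z)) as T1.
    pose proof (pm_tri _ Hd gone (v n 0%Z) (v n (Z.of_nat (hi n)))) as T2.
    rewrite H3, opp_IZR, <- INR_IZR_INZ in T1 by lia. rewrite H3, <- INR_IZR_INZ in T2 by lia.
    pose proof (pos_INR (lo n)). pose proof (pos_INR (hi n)).
    rewrite Rabs_right in T1 by lra. rewrite Rabs_left1 in T2 by lra.
    split; apply INR_le; lra. }
  assert (Hball : forall r, exists l, forall g, d gone g <= r -> In g l) by (apply ball_finite; auto).
  apply fun_choice in Hball. destruct Hball as [B HB].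
  (* The vertices at [m] and [-m] form one coordinate, so a sequence over [nat] encodes a two-sided
     line. *)
  destruct (konig (fun m => list_prod (B (D + INR m)) (B (D + INR m)))
      (fun n m => (v n (Z.of_nat m), v n (- Z.of_nat m)%Z))) as [cc Hcc].
  { intros m. destruct (Hlong m) as [N HN]. exists N. intros n Hn. destruct (HN n Hn) as [L1 L2].
    destruct (Hs n) as (_ & _ & H3 & H4 & _). fold (v n) (lo n) (hi n) in *.
    pose proof (pos_INR m) as Hm.
    apply in_prod; apply HB.
    - pose proof (pm_tri _ Hd gone (v n 0%Z) (v n (Z.of_nat m))) as T.
      rewrite H3, <- INR_IZR_INZ in T by lia. rewrite Rabs_left1 in T by lra. lra.
    - pose proof (pm_tri _ Hd gone (v n 0%Z) (v n (- Z.of_nat m)%Z)) as T.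
      rewrite H3, opp_IZR, <- INR_IZR_INZ in T by lia. rewrite Rabs_right in T by lra. lra. }
  set (c := fun z => if Z_le_gt_dec 0 z then fst (cc (Z.to_nat z)) else snd (cc (Z.to_nat (- z)))).
  assert (Hc : forall m N : nat, exists n, (N <= n)%nat /\ (m <= lo n)%nat /\ (m <= hi n)%nat /\
     forall z, (Z.abs z <= Z.of_nat m)%Z -> v n z = c z).
  { intros m N. destruct (Hlong m) as [N' HN'].
    destruct (Hcc (Datatypes.S m) (max N N')) as (n & Hn & Hj). exists n.
    destruct (HN' n ltac:(lia)) as [L1 L2]. repeat split; auto; [lia|].
    intros z Hz. unfold c. destruct (Z_le_gt_dec 0 z) as [H|H].
    - rewrite <- Hj by lia. simpl. f_equal. lia.
    - rewrite <- Hj by lia. simpl. f_equal. lia. }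
  exists c. split; [|split].
  - intros i j. destruct (Hc (Z.to_nat (Z.max (Z.abs i) (Z.abs j))) O) as (n & _ & L1 & L2 & E).
    rewrite <- !E by lia. apply (Hs n); fold (lo n) (hi n); lia.
  - intros e He M.
    destruct (powers_gprod_large a Ha (M + delta)) as [N HN].
    destruct (archimed_nat (M + delta + D)) as [K HK].
    exists (Z.of_nat K), N. intros z n Hz Hn.
    destruct (Hc (Z.to_nat (Z.abs z)) N) as (n' & Hn' & L1 & L2 & E).
    rewrite <- E by lia.
    (* On the geodesic, [z] lies between 0 and the end, so the product based at index 0 is [|z|];
       moving the base to the identity costs [D]. *)
    assert (Hlarge : M + delta <= gprod d gone (v n' z) (zpow a (e * Z.of_nat n'))).
    { destruct (Hs n') as (H1 & H2 & H3 & H4 & _). fold (v n') (lo n') (hi n') in *.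
      assert (Hend : exists w, v n' w = zpow a (e * Z.of_nat n') /\ (- Z.of_nat (lo n') <= w <= Z.of_nat (hi n'))%Z
         /\ (Z.abs z <= e * w)%Z).
      { destruct He as [->| ->].
        - exists (Z.of_nat (hi n')). rewrite H2. split; [f_equal; lia | lia].
        - exists (- Z.of_nat (lo n'))%Z. rewrite H1. split; [f_equal; lia | lia]. }
      destruct Hend as (w & <- & Hw & Hzw).
      pose proof (gprod_base_lip _ Hd (v n' 0%Z) gone (v n' z) (v n' w)) as T.
      rewrite (pm_sym _ Hd (v n' 0%Z) gone) in T.
      assert (Hg : INR K <= gprod d (v n' 0%Z) (v n' z) (v n' w)).
      { unfold gprod. rewrite !H3 by lia. rewrite INR_IZR_INZ.
        assert (Hz' : (Z.of_nat K <= Z.abs z)%Z) by (destruct He; subst; lia).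
        assert (X : (Z.abs z + Z.abs w - Z.abs (z - w) = 2 * Z.abs z)%Z)
          by (destruct He; subst; lia).
        rewrite <- !minus_IZR, !Rabs_Zabs, !Z.sub_0_r, <- plus_IZR, <- minus_IZR, X, mult_IZR.
        apply IZR_le in Hz'. lra. }
      lra. }
    pose proof (hyp_ge _ delta Hhyp gone (v n' z) (zpow a (e * Z.of_nat n')) (zpow a (e * Z.of_nat n)) (M + delta) Hlarge (HN e He n' n Hn' Hn)). lra.
  - exists D. intros n.
    (* [K] bounds the index of any point within [D] of [a^n], whatever [n'] is, so the point falls
       in the window where the approximating geodesic agrees with [c]. *)
    destruct (archimed_nat (D + d gone (gpow a n) + D)) as [K HK].
    destruct (Hc K n) as (n' & Hn' & L1 & L2 & E).
    destruct (Hs n') as (H1 & H2 & H3 & H4 & H5). fold (v n') (lo n') (hi n') in *.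
    destruct (H5 (gpow a n)) as (j & Hj & Hjd).
    { rewrite <- zpow_of_nat. apply (axis_between S); auto. lia. }
    exists j. rewrite <- E; auto.
    pose proof (pm_tri _ Hd (v n' 0%Z) gone (v n' j)) as T1.
    pose proof (pm_tri _ Hd gone (gpow a n) (v n' j)) as T2.
    rewrite (pm_sym _ Hd (v n' 0%Z) gone), H3 in T1 by lia.
    rewrite <- minus_IZR, Rabs_Zabs in T1. rewrite INR_IZR_INZ in HK.
    apply le_IZR. replace (0 - j)%Z with (- j)%Z in T1 by lia. rewrite Z.abs_opp in T1. lra.
Qed.

Lemma exists_geodesic_in_LS (A : G -> Prop) (a : G) : A a -> loxodromic S a ->
  exists c, in_LS S A c /\
    exists D, forall n, exists t v, c t = CV v /\ d (gpow a n) v <= D.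
Proof.
  intros HA Ha.
  destruct (exists_axis_line a Ha) as (c & Hc & Hends & [D HD]).
  destruct (line_param S HS c Hc) as (gam & Hgeo & Hint & Hvert).
  exists gam. split.
  - exists a. split; [exact HA|]. split; [now apply (loxodromic_infinite_order S HS)|]. split; [exact Hgeo|].
    assert (Hprod : forall M k t g, base_vertex (gam t) = c k -> M + 3 <= gprod d gone (c k) g ->
      gprod (cdist S) (CV gone) (gam t) (CV g) >= M).
    { intros M k t g Hk HM. pose proof (gprod_cdist_bounds S HS (gam t) (CV g) gone (proj1 Hgeo t) I) as H.
      rewrite Hk in H. simpl in H. lra. }
    split; intros M.
    + destruct (Hends 1%Z (or_introl eq_refl) (M + 3)) as (K & N & H).
      (* The extra 1 is the gap between [t] and the index of its base vertex. *)
      exists (IZR K + 1), N. intros t n Ht Hn. destruct (Hvert t) as (k & Hk & Ek).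
      apply (Hprod M k); auto. rewrite <- zpow_of_nat, <- (Z.mul_1_l (Z.of_nat n)).
      apply H; auto. apply le_IZR. rewrite Z.mul_1_l.
      revert Hk. unfold Rabs. destruct (Rcase_abs _); lra.
    + destruct (Hends (-1)%Z (or_intror eq_refl) (M + 3)) as (K & N & H).
      exists (- (IZR K + 1)), N. intros t n Ht Hn. destruct (Hvert t) as (k & Hk & Ek).
      apply (Hprod M k); auto. rewrite <- zpow_opp_of_nat, Z.opp_eq_mul_m1, Z.mul_comm.
      apply H; auto. apply le_IZR. rewrite mult_IZR.
      revert Hk. unfold Rabs. destruct (Rcase_abs _); lra.
  - exists D. intros n. destruct (HD n) as [z Hz]. exists (IZR z), (c z). auto.
Qed.

End Axes.

(** * Orbit maps *)

Lemma mdist_pm (X : MetricSpace) : pseudometric (@mdist X).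
Proof. split; [apply md_self | apply md_sym | apply md_tri]. Qed.

Lemma trans_len_le {X : MetricSpace} (f : X -> X) (x : X) : trans_len f <= mdist x (f x).
Proof.
  apply glb_le with 0; [|eauto].
  intros r [y ->]. apply (pm_nonneg _ (mdist_pm X)).
Qed.

Lemma trans_len_ge {X : MetricSpace} (f : X -> X) (m : R) :
  inhabited X -> (forall x, m <= mdist x (f x)) -> m <= trans_len f.
Proof.
  intros [x] H. apply glb_ge; [now exists (mdist x (f x)), x|]. intros r [y ->]. apply H.
Qed.

Section Orbit.
Context {G : Group} (S : list G) (X : MetricSpace) (rho : G -> X -> X).
Hypothesis HS : generates S.
Hypothesis Hrho : is_rep G X rho.
Notation d := (word_dist S).
Let Hd : pseudometric d := word_dist_pm S HS.
Let HX : pseudometric (@mdist X) := mdist_pm X.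

Lemma rep_isom g (x y : X) : mdist (rho g x) (rho g y) = mdist x y.
Proof. apply Hrho. Qed.

Lemma rep_mul g h (x : X) : rho (gmul g h) x = rho g (rho h x).
Proof. apply Hrho. Qed.

(** [is_rep] asks only for multiplicativity: [rho gone] is idempotent and, as an isometry,
    injective. *)
Lemma rep_one (x : X) : rho gone x = x.
Proof.
  apply md_eq. rewrite <- (rep_isom gone), <- rep_mul, gmul1l. apply md_self.
Qed.

Lemma orbit_dist g h (x : X) : mdist (rho g x) (rho h x) = mdist x (rho (gmul (ginv g) h) x).
Proof.
  rewrite <- (rep_isom g x (rho _ x)), <- rep_mul. now rewrite gmulVK.
Qed.

Lemma displacement_mul g h (x : X) :
  mdist x (rho (gmul g h) x) <= mdist x (rho g x) + mdist x (rho h x).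
Proof.
  rewrite rep_mul, <- (rep_isom g x (rho h x)). apply md_tri.
Qed.

Lemma displacement_inv g (x : X) : mdist x (rho (ginv g) x) = mdist x (rho g x).
Proof.
  rewrite <- (rep_isom g), <- rep_mul, gmulVr, rep_one. apply md_sym.
Qed.

Lemma displacement_gpow g n (x : X) : mdist x (rho (gpow g n) x) <= INR n * mdist x (rho g x).
Proof.
  induction n as [|n IH].
  - simpl. rewrite rep_one, md_self. lra.
  - rewrite S_INR. simpl. pose proof (displacement_mul g (gpow g n) x). lra.
Qed.

Lemma orbit_lipschitz (x : X) : exists L, 0 <= L /\
  forall g h, mdist (rho g x) (rho h x) <= L * d g h.
Proof.
  assert (HL : exists L, 0 <= L /\ forall s, In s S -> mdist x (rho s x) <= L).
  { clear. generalize S. intros l. induction l as [|s l (L & HL & IH)].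
    - exists 0. split; [lra | simpl; tauto].
    - exists (Rmax L (mdist x (rho s x))). split.
      + apply Rle_trans with L; [auto | apply Rmax_l].
      + intros s' [<-|Hs']; [apply Rmax_r|].
        apply Rle_trans with L; [auto | apply Rmax_l]. }
  destruct HL as (L & HL & Hgen). exists L. split; auto. intros g h.
  rewrite orbit_dist. destruct (word_dist_attained S HS g h) as (w & Hw & <- & ->).
  induction w as [|[s b] w IH].
  - simpl. rewrite rep_one, md_self. lra.
  - inversion Hw as [|? ? Hs Hw']; subst. specialize (IH Hw'). simpl in Hs.
    change (length ((s, b) :: w)) with (Datatypes.S (length w)). rewrite S_INR. simpl.
    eapply Rle_trans; [apply displacement_mul|].
    assert (mdist x (rho (if b then ginv s else s) x) <= L).
    { destruct b; [rewrite displacement_inv|]; auto. }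
    lra.
Qed.

(** One segment from [x] to [rho s x] is chosen for each [s] and translated by [rho g], which makes
    the map equivariant. *)
Lemma exists_orbit_map (x : X) : geodesic_space X -> exists tau, orbit_map S X rho x tau.
Proof.
  intros Hgeo.
  assert (Hc : forall s, exists c : R -> X, c 0 = x /\ c (mdist x (rho s x)) = rho s x /\
    forall t t', 0 <= t <= mdist x (rho s x) -> 0 <= t' <= mdist x (rho s x) ->
      mdist (c t) (c t') = Rabs (t - t')) by (intros s; apply Hgeo).
  apply fun_choice in Hc. destruct Hc as [c Hc].
  assert (Hscale : forall t r : R, 0 <= r -> 0 < t < 1 -> 0 <= t * r <= r) by (intros; nra).
  exists (fun p => match p with CV g => rho g x | CE g s t => rho g (c s (t * mdist x (rho s x))) end).
  split; [reflexivity|]. split; [|split].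
  - intros gam [g|g s t] _; simpl; apply rep_mul.
  - intros g s t t' _ Ht Ht'. destruct (Hc s) as (H0 & H1 & H2).
    pose proof (pm_nonneg _ HX x (rho s x)) as Hn.
    rewrite rep_isom, H2 by auto.
    rewrite <- Rmult_minus_distr_r, Rabs_mult, (Rabs_right (mdist x (rho s x))); lra.
  - intros g s t _ Ht. destruct (Hc s) as (H0 & H1 & H2).
    pose proof (pm_nonneg _ HX x (rho s x)) as Hn.
    pose proof (Hscale t _ Hn Ht) as Hb. split.
    + rewrite rep_isom. rewrite <- H0 at 1. rewrite H2 by lra.
      rewrite Rabs_left1; lra.
    + rewrite rep_mul, rep_isom. rewrite <- H1 at 2. rewrite H2 by lra.
      rewrite Rabs_left1; lra.
Qed.

Lemma orbit_map_near_vertex (x : X) tau L : orbit_map S X rho x tau -> 0 <= L ->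
  (forall g h, mdist (rho g x) (rho h x) <= L * d g h) ->
  forall p, cvalid S p -> mdist (rho (base_vertex p) x) (tau p) <= L.
Proof.
  intros (H1 & _ & _ & H4) HL Hlip [g|g s t]; simpl.
  - rewrite H1, md_self. auto.
  - intros [Hs Ht]. destruct (H4 g s t Hs Ht) as [-> _].
    pose proof (Hlip gone s) as A. rewrite rep_one in A.
    pose proof (word_dist_generator S gone s Hs) as B. rewrite gmul1l in B.
    pose proof (pm_nonneg _ HX x (rho s x)). nra.
Qed.

(** Passing from [x] to [y] changes the displacement of every power by at most [2 d(x, y)], so
    growth along one orbit bounds the displacement of all points. *)
Lemma displacement_ge_of_growth g e c (x : X) :
  (forall n, INR n * e - c <= mdist x (rho (gpow g n) x)) -> forall y : X, e <= mdist y (rho g y).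
Proof.
  intros H y. apply linear_growth_le with (c + 2 * mdist x y). intros n.
  specialize (H n). pose proof (displacement_gpow g n y).
  pose proof (md_tri _ x y (rho (gpow g n) x)).
  pose proof (md_tri _ y (rho (gpow g n) y) (rho (gpow g n) x)).
  rewrite rep_isom, (md_sym _ y x) in *. lra.
Qed.

Lemma trans_len_conj_ge g f m : inhabited X ->
  (forall y : X, m <= mdist y (rho (gmul (ginv f) (gmul g f)) y)) -> m <= trans_len (rho g).
Proof.
  intros Hi H. apply trans_len_ge; auto. intros y.
  specialize (H (rho (ginv f) y)).
  rewrite <- rep_mul in H. autorewrite with grp in H.
  rewrite rep_mul, rep_isom in H. exact H.
Qed.

End Orbit.

(** * Translation lengths and the two implications *)

Lemma growth_conj {G : Group} (S : list G) (HS : generates S) (h : G) (m : R) :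
  (forall n, INR n * m <= word_dist S gone (gpow h n)) ->
  forall g, m <= word_dist S gone (gmul (ginv g) (gmul h g)).
Proof.
  (* Conjugation by [g] changes the length of every power by at most [2 |g|]. *)
  intros H g. apply linear_growth_le with (2 * word_dist S gone g). intros n.
  specialize (H n). pose proof (word_dist_pm S HS) as Hd.
  set (h' := gmul (ginv g) (gmul h g)) in *.
  assert (E : gpow h n = gmul g (gmul (gpow h' n) (ginv g))).
  { rewrite <- !zpow_of_nat, <- zpow_conj. f_equal. unfold h'. grp. }
  rewrite E in H.
  assert (Hmul : forall u v, word_dist S gone (gmul u v) <= word_dist S gone u + word_dist S gone v).
  { intros u v. pose proof (pm_tri _ Hd gone u (gmul u v)) as T.
    rewrite (word_dist_one S u (gmul u v)), gmulKV in T. exact T. }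
  pose proof (Hmul g (gmul (gpow h' n) (ginv g))). pose proof (Hmul (gpow h' n) (ginv g)) as T.
  rewrite (word_dist_inv S HS) in T. pose proof (word_dist_gpow_le S HS h' n). lra.
Qed.

Lemma stable_displacement {G : Group} (S : list G) (X : MetricSpace) (rho : G -> X -> X)
    (A : G -> Prop) (delta K C : R) (x : X) tau (a : G) (e : R) :
  generates S -> 0 <= delta -> hyperbolic_with delta (word_dist S) -> is_rep G X rho ->
  1 <= K -> orbit_map S X rho x tau ->
  (forall c, in_LS S A c -> quasi_geodesic K C (fun t => tau (c t))) ->
  A a -> loxodromic S a -> (forall n, INR n * e <= word_dist S gone (gpow a n)) ->
  forall y, / K * e <= mdist y (rho a y).
Proof.
  intros HS Hdelta Hhyp Hrho HK Htau Hstab HA Ha He.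
  pose proof (word_dist_pm S HS) as Hd.
  destruct (exists_geodesic_in_LS S delta HS Hhyp A a HA Ha) as (c & Hc & D & HD).
  specialize (Hstab c Hc). destruct Hc as (_ & _ & _ & [_ Hgeo] & _).
  destruct (orbit_lipschitz S X rho HS Hrho x) as (L & HL & Hlip).
  assert (HiK : 0 < / K) by (apply Rinv_0_lt_compat; lra).
  destruct (HD O) as (t0 & v0 & E0 & D0). simpl in D0.
  (* Replacing [1] and [a^n] by vertices of the line costs [2 D], and passing to [cdist] costs 2,
     both before division by [K]; moving their images back to the orbit costs [2 L D]. *)
  apply displacement_ge_of_growth with (x := x) (c := / K * (2 * D + 2) + C + 2 * L * D); auto.
  intros n. specialize (He n). destruct (HD n) as (t & v & E & Dn).
  pose proof (Hgeo t t0) as G1. rewrite E, E0 in G1.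
  pose proof (cdist_bounds S HS (CV v) (CV v0) I I) as G2. simpl in G2.
  destruct (Hstab t t0) as [Hq _]. rewrite E, E0 in Hq.
  destruct Htau as (Hv & _). rewrite !Hv in Hq.
  pose proof (pm_tri _ Hd gone v0 (gpow a n)) as T1.
  pose proof (pm_tri _ Hd v0 v (gpow a n)) as T2.
  pose proof (pm_sym _ Hd v v0) as S1. pose proof (pm_sym _ Hd v (gpow a n)) as S2.
  pose proof (pm_sym _ Hd v0 gone) as S3.
  pose proof (Hlip (gpow a n) v) as L1. pose proof (Hlip v0 gone) as L2.
  rewrite (rep_one X rho Hrho) in L2.
  pose proof (md_tri _ (rho v x) (rho (gpow a n) x) (rho v0 x)) as M1.
  pose proof (md_tri _ (rho (gpow a n) x) x (rho v0 x)) as M2.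
  pose proof (md_sym _ (rho v x) (rho (gpow a n) x)) as S4.
  pose proof (md_sym _ x (rho v0 x)) as S5. pose proof (md_sym _ x (rho (gpow a n) x)) as S6.
  assert (B1 : L * word_dist S (gpow a n) v <= L * D) by (apply Rmult_le_compat_l; auto; lra).
  assert (B2 : L * word_dist S v0 gone <= L * D) by (apply Rmult_le_compat_l; auto; lra).
  assert (B3 : / K * (INR n * e - 2 * D - 2) <= / K * Rabs (t - t0)) by (apply Rmult_le_compat_l; lra).
  lra.
Qed.

Lemma stable_well_displacing {G : Group} (S : list G) (X : MetricSpace) (rho : G -> X -> X)
    (A : G -> Prop) :
  hyperbolic_group G S -> inhabited X -> is_rep G X rho -> characteristic A ->
  A_stable S X rho A -> A_well_displacing S X rho A.
Proof.
  intros [HS (delta & Hdelta & Hhyp)] Hi Hrho HA (K & C & x & tau & HK & HC & Htau & Hstab).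
  destruct (orbit_lipschitz S X rho HS Hrho x) as (L & HL & Hlip).
  (* The first term absorbs the gap of 2 in the upper bound; [7 delta + 4] bounds the translation
     length of the short elements below. *)
  exists (K + L), (2 * (K + L) + 7 * delta + 4). split; [lra|]. split; [lra|]. intros a Ha.
  destruct (exists_shortest_conjugate S HS a) as [f Hf].
  set (a' := gmul (ginv f) (gmul a f)) in *.
  assert (Hup : cayley_trans_len S a <= word_dist S gone a' + 2) by now apply cayley_trans_len_le.
  assert (Hlow : word_dist S gone a' - 2 <= cayley_trans_len S a) by now apply cayley_trans_len_ge.
  assert (Hpos := pm_nonneg _ (word_dist_pm S HS) gone a').
  split.
  - assert (HJ : 0 < / (K + L) <= 1).
    { split; [apply Rinv_0_lt_compat; lra|]. rewrite <- Rinv_1. apply Rinv_le_contravar; lra. }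
    (* With turn bound [k = 2 delta], being loxodromic requires length above
       [2 k + 3 delta = 7 delta]. *)
    destruct (Rle_or_lt (word_dist S gone a') (7 * delta + 2)) as [Hshort|Hlong].
    + apply Rle_trans with 0.
      * assert (/ (K + L) * cayley_trans_len S a <= / (K + L) * (7 * delta + 4))
          by (apply Rmult_le_compat_l; lra).
        nra.
      * apply trans_len_ge; auto. intros y. apply (pm_nonneg _ (mdist_pm X)).
    + assert (Hturn : gprod (word_dist S) gone (ginv a') a' <= 2 * delta).
      { apply shortest_conjugate_small_turn; auto; [|lra].
        intros g. specialize (Hf (gmul f g)). unfold a'.
        autorewrite with grp in *. exact Hf. }
      assert (Hlox : loxodromic S a') by (apply small_turn_loxodromic with delta (2 * delta); auto; lra).
      assert (HA' : A a').
      { unfold a'. rewrite <- (ginv_inv f) at 2. now apply characteristic_conj. }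
      assert (HK1 : 0 < / K) by (apply Rinv_0_lt_compat; lra).
      assert (HKL : / (K + L) <= / K) by (apply Rinv_le_contravar; lra).
      assert (Hdisp : / K * (word_dist S gone a' - 2 * (2 * delta) - 2 * delta) <= trans_len (rho a)).
      { apply trans_len_conj_ge with f; auto. fold a'.
        apply stable_displacement with S A delta C x tau; auto.
        intros n. apply small_turn_powers; auto. lra. }
      set (l := word_dist S gone a') in *. set (t := trans_len (rho a)) in *.
      assert (/ (K + L) * cayley_trans_len S a <= / (K + L) * (l + 2)) by (apply Rmult_le_compat_l; lra).
      assert (/ (K + L) * (l - 2 * (2 * delta) - 2 * delta) <= / K * (l - 2 * (2 * delta) - 2 * delta))
        by (apply Rmult_le_compat_r; lra).
      assert (/ (K + L) * (6 * delta + 2) <= 6 * delta + 2) by nra.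
      lra.
  - eapply Rle_trans; [apply (trans_len_le _ (rho f x))|].
    rewrite <- (rep_mul X rho Hrho). eapply Rle_trans; [apply Hlip|].
    rewrite (word_dist_one S f). fold a'.
    assert (L * word_dist S gone a' <= (K + L) * (cayley_trans_len S a + 2)).
    { apply Rmult_le_compat; lra. }
    lra.
Qed.

Lemma well_displacing_quasi_isometric {G : Group} (S : list G) (X : MetricSpace) (rho : G -> X -> X)
    (A : G -> Prop) (delta J B : R) (b : G) (x : X) :
  generates S -> 0 <= delta -> hyperbolic_with delta (word_dist S) -> non_elementary G ->
  is_rep G X rho -> characteristic A -> A b -> loxodromic S b -> 1 <= J -> 0 <= B ->
  (forall a, A a -> / J * cayley_trans_len S a - B <= trans_len (rho a)) ->
  exists C, 0 <= C /\ forall w, / J * word_dist S gone w - C <= mdist x (rho w x).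
Proof.
  intros HS Hdelta Hhyp Hne Hrho HA HAb Hb HJ HB Hwd.
  destruct (exists_long_twisted_product S delta HS Hdelta Hhyp A b Hne HA HAb Hb) as (C & r & Hprod).
  destruct (orbit_lipschitz S X rho HS Hrho x) as (L & HL & Hlip).
  assert (HiJ : 0 < / J <= 1).
  { split; [apply Rinv_0_lt_compat; lra|]. rewrite <- Rinv_1. apply Rinv_le_contravar; lra. }
  pose proof (Rabs_pos C) as HC0. pose proof (Rle_abs C) as HC1.
  pose proof (Rabs_pos r) as Hr0. pose proof (Rle_abs r) as Hr1.
  assert (HLr : 0 <= L * Rabs r) by now apply Rmult_le_pos.
  (* Half of the error in the comparison for [h], which involves [w] twice, enlarged to cover
     [|w| <= C]. The absolute values are there because [C] and [r] come without a sign. *)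
  exists (Rabs C + 1 + B + L * Rabs r). split; [lra|]. intros w.
  assert (Hw0 := pm_nonneg _ (word_dist_pm S HS) gone w).
  assert (Hm0 := pm_nonneg _ (mdist_pm X) x (rho w x)).
  destruct (Rle_or_lt (word_dist S gone w) C) as [Hle|Hlt].
  - assert (/ J * word_dist S gone w <= C) by nra. lra.
  - destruct (Hprod w Hlt) as (b1 & b2 & Hb1 & Hb2 & HAh & Hgrow).
    set (h := gmul b1 (gmul w (gmul b2 (ginv w)))) in *.
    pose proof (cayley_trans_len_ge S HS h _ (growth_conj S HS h _ Hgrow)) as Hctl.
    specialize (Hwd h HAh). pose proof (trans_len_le (rho h) x) as Ht.
    pose proof (displacement_mul X rho Hrho b1 (gmul w (gmul b2 (ginv w))) x) as D1.
    pose proof (displacement_mul X rho Hrho w (gmul b2 (ginv w)) x) as D2.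
    pose proof (displacement_mul X rho Hrho b2 (ginv w) x) as D3.
    rewrite (displacement_inv X rho Hrho) in D3. fold h in D1.
    assert (Hbd : forall g, word_dist S gone g <= r -> mdist x (rho g x) <= L * Rabs r).
    { intros g Hg. pose proof (Hlip gone g) as E. rewrite (rep_one X rho Hrho) in E.
      apply Rle_trans with (1 := E). apply Rmult_le_compat_l; lra. }
    specialize (Hbd b1 Hb1) as F1. specialize (Hbd b2 Hb2) as F2.
    assert (/ J * (2 * word_dist S gone w - C - 2) <= / J * cayley_trans_len S h)
      by (apply Rmult_le_compat_l; lra).
    assert (/ J * (C + 2) <= Rabs C + 2).
    { apply Rle_trans with (/ J * (Rabs C + 2)); [apply Rmult_le_compat_l; lra | nra]. }
    lra.
Qed.

Lemma quasi_isometric_quasi_geodesic {G : Group} (S : list G) (X : MetricSpace) (rho : G -> X -> X)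
    (J C : R) (x : X) tau :
  generates S -> is_rep G X rho -> 1 <= J -> 0 <= C -> orbit_map S X rho x tau ->
  (forall w, / J * word_dist S gone w - C <= mdist x (rho w x)) ->
  exists K C', 1 <= K /\ 0 <= C' /\
    forall c, cgeodesic S c -> quasi_geodesic K C' (fun t => tau (c t)).
Proof.
  intros HS Hrho HJ HC Htau Hqi.
  destruct (orbit_lipschitz S X rho HS Hrho x) as (L & HL & Hlip).
  (* Moving both ends to base vertices costs [2 L] in [X] and 2 in the Cayley graph; the latter
     becomes at most 2 below and [2 L] above. *)
  exists (J + L), (C + 4 * L + 2). split; [lra|]. split; [lra|].
  intros c [Hv Hgeo] s t.
  pose proof (orbit_map_near_vertex S X rho Hrho x tau L Htau HL Hlip (c s) (Hv s)) as Ns.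
  pose proof (orbit_map_near_vertex S X rho Hrho x tau L Htau HL Hlip (c t) (Hv t)) as Nt.
  pose proof (cdist_bounds S HS (c s) (c t) (Hv s) (Hv t)) as Hb. rewrite Hgeo in Hb.
  set (u := base_vertex (c s)) in *. set (v := base_vertex (c t)) in *.
  pose proof (Hlip u v) as Hup. pose proof (Hqi (gmul (ginv u) v)) as Hlow.
  rewrite <- (word_dist_one S), <- (orbit_dist X rho Hrho) in Hlow.
  pose proof (md_tri _ (tau (c s)) (rho u x) (tau (c t))) as M1.
  pose proof (md_tri _ (rho u x) (rho v x) (tau (c t))) as M2.
  pose proof (md_tri _ (rho u x) (tau (c s)) (rho v x)) as M3.
  pose proof (md_tri _ (tau (c s)) (tau (c t)) (rho v x)) as M4.
  rewrite (md_sym _ (tau (c s)) (rho u x)) in M1.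
  rewrite (md_sym _ (tau (c t)) (rho v x)) in M4.
  assert (Hs : 0 <= Rabs (s - t)) by apply Rabs_pos.
  assert (HiJ : 0 < / J <= 1).
  { split; [apply Rinv_0_lt_compat; lra|]. rewrite <- Rinv_1. apply Rinv_le_contravar; lra. }
  assert (HJL : / (J + L) <= / J) by (apply Rinv_le_contravar; lra).
  split.
  - assert (/ (J + L) * Rabs (s - t) <= / J * Rabs (s - t)) by (apply Rmult_le_compat_r; lra).
    assert (/ J * (Rabs (s - t) - 2) <= / J * word_dist S u v) by (apply Rmult_le_compat_l; lra).
    lra.
  - assert (L * word_dist S u v <= L * (Rabs (s - t) + 2)) by (apply Rmult_le_compat_l; lra).
    assert (0 <= J * Rabs (s - t)) by (apply Rmult_le_pos; lra).
    lra.
Qed.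

Lemma well_displacing_stable {G : Group} (S : list G) (X : MetricSpace) (rho : G -> X -> X)
    (A : G -> Prop) :
  hyperbolic_group G S -> non_elementary G -> geodesic_space X -> inhabited X ->
  is_rep G X rho -> characteristic A ->
  A_well_displacing S X rho A -> A_stable S X rho A.
Proof.
  intros [HS (delta & Hdelta & Hhyp)] Hne Hgeo [x] Hrho HA (J & B & HJ & HB & Hwd).
  destruct (exists_orbit_map S X rho Hrho x Hgeo) as [tau Htau].
  (* A single line provides the loxodromic element from which all segments are controlled; without
     any line, stability is vacuous. *)
  destruct (classic (exists c, in_LS S A c)) as [(c0 & b & HAb & _ & Hc0 & Hj0)|Hno].
  - pose proof (geodesic_line_loxodromic S delta HS Hdelta Hhyp b c0 Hc0 Hj0) as Hb.
    destruct (well_displacing_quasi_isometric S X rho A delta J B b x) as (C & HC & Hqi); auto.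
    { intros a Ha. now apply Hwd. }
    destruct (quasi_isometric_quasi_geodesic S X rho J C x tau) as (K & C' & HK & HC' & Hq); auto.
    exists K, C', x, tau. split; [auto|]. split; [auto|]. split; [auto|]. intros c (a & _ & _ & Hc & _). exact (Hq c Hc).
  - exists 1, 0, x, tau. split; [lra|]. split; [lra|]. split; auto.
    intros c Hc. exfalso. eauto.
Qed.

Theorem mainTheorem2 (G : Group) (S : list G) (X : MetricSpace)
    (rho : G -> X -> X) (A : G -> Prop) :
  hyperbolic_group G S -> non_elementary G ->
  gromov_hyperbolic (@mdist X) -> proper_space X -> geodesic_space X ->
  inhabited X ->
  is_rep G X rho -> characteristic A ->
  (A_stable S X rho A <-> A_well_displacing S X rho A).
Proof.
  intros HG Hne _ _ Hgeo Hi Hrho HA. split.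
  - now apply stable_well_displacing.
  - now apply well_displacing_stable.
Qed.
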